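(* Let $0<r\le 1$, let $\mu\prec 1$, and suppose that $\mathbb{V}[S_{t,T}-\hat S^{(\mathrm{GT})}_{t,T}]\to\infty$ as $t\to\infty$. Let $$\hat V_t:=\sum_{s\in\mathcal S}1_{N_s>0}\,r^{2N_s}+\hat S^{(\mathrm{GT})}_{t,T}.$$ Then, as $t\to\infty$, $$\frac{S_{t,T}-\hat S^{(\mathrm{GT})}_{t,T}}{\sqrt{\hat V_t}}\ \overset{d}{\longrightarrow}\ \mathcal N(0,1).$$
   Context: Setting (Poissonized unseen species problem). $\mathcal{S}$ is an at most countable set of species and $\mu$ is a probability measure on $2^{\mathcal S}$ supported on finite sets (the empty set may carry mass); $\mu\prec 1$ means $\mu(A)=0$ whenever $|A|>1$. $t,t'>0$, $r=t'/t$, $T=t+t'=(1+r)t$. Let $X_1,X_2,\dots$ be i.i.d. from $\mu$, and let $n\sim\mathrm{Poisson}(t)$, $m\sim\mathrm{Poisson}(t')$ be independent of each other and of the $X_i$. The first expedition observes $X_1,\dots,X_n$, the second $X_{n+1},\dots,X_{n+m}$. For $s\in\mathcal S$, $N_s$ (resp. $N_s'$) is the number of sets observed in the first (resp. second) expedition that contain $s$. $S_t=|\{s:N_s>0\}|$, $S_T=|\{s:N_s+N_s'>0\}|$, $S_{t,T}=S_T-S_t$. The Good--Toulmin estimator is $\hat S^{(\mathrm{GT})}_{t,T}=-\sum_{s\in\mathcal S}1_{N_s>0}(-r)^{N_s}$. $\mathbb V$ denotes variance. When $\hat V_t\le 0$ the ratio is assigned an arbitrary fixed value (the choice is immaterial).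 *)

(* Defs.v *)
From HB Require Import structures.
From mathcomp Require Export all_boot all_order all_algebra finmap.
From mathcomp Require Export all_classical all_reals all_analysis.

Set Implicit Arguments.
Unset Strict Implicit.
Unset Printing Implicit Defensive.

Import Order.TTheory GRing.Theory Num.Theory.
Export numFieldNormedType.Exports.

Local Open Scope classical_set_scope.
Local Open Scope ring_scope.

(* The law of one observation is supported on the finite subsets of the
   countable type [S]; these form the countable type [{fset S}], so the discrete
   sigma-algebra is the right one. *)
HB.instance Definition _ (S : countType) :=
  @isMeasurable.Build default_measure_display {fset S} discrete_measurable
    discrete_measurable0 discrete_measurableC discrete_measurableU.

Definition mutually_independent d (Omega : measurableType d) (R : realType)
    (P : probability Omega R) (I : choiceType) (F : I -> set (set Omega)) :=
  forall (J : {fset I}) (A : I -> set Omega),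
    (forall i, i \in J -> F i (A i)) ->
    P (\bigcap_(i in [set` J]) A i) = (\prod_(i <- J) P (A i))%E.

Definition cvg_in_distribution (R : realType) (d : R -> measure_display)
    (Omega : forall t, measurableType (d t))
    (P : forall t, probability (Omega t) R)
    (Z : forall t, {RV (P t) >-> R}) (nu : probability (measurableTypeR R) R) :=
  forall x : R, {for x, continuous (fun y : R => nu `]-oo, y]%classic)} ->
    cdf (Z t) x @[t --> +oo%R] --> nu `]-oo, x]%classic.

(* Statistics of the observed sets: [xs] is the list of the sets seen in the
   first expedition, [ys] that of the sets seen in the second one. *)
Section statistics.
Context {R : realType} {S : countType}.
Implicit Types (xs ys : seq {fset S}) (s : S) (r : R).

Definition abundance xs s : nat := count (fun A : {fset S} => s \in A) xs.

Definition num_species xs : nat :=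
  #|` fset_set [set s | (0 < abundance xs s)%N] |.

Definition num_species_both xs ys : nat :=
  #|` fset_set [set s | (0 < abundance xs s + abundance ys s)%N] |.

Definition num_new_species xs ys : R :=
  (num_species_both xs ys)%:R - (num_species xs)%:R.

(* Only finitely many species are observed, so the sums [\sum_(s \in _)] over
   finite supports below are the actual sums over all species. *)
Definition good_toulmin r xs : R :=
  - \sum_(s \in [set: S]) ((0 < abundance xs s)%N%:R * (- r) ^+ abundance xs s).

Definition prediction_error r xs ys : R :=
  num_new_species xs ys - good_toulmin r xs.

Definition variance_estimator r xs : R :=
  \sum_(s \in [set: S]) ((0 < abundance xs s)%N%:R * r ^+ (2 * abundance xs s))
  + good_toulmin r xs.

(* [c] is the value given to the ratio when the variance estimator is not
   positive. *)
Definition studentized_error r (c : R) xs ys : R :=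
  if 0 < variance_estimator r xs then
    prediction_error r xs ys / Num.sqrt (variance_estimator r xs)
  else c.

End statistics.

Section expeditions.
Context d (Omega : measurableType d) (R : realType) (P : probability Omega R).
Context (S : countType).
Variables (X : nat -> {RV P >-> {fset S}}) (n m : {RV P >-> nat}).

(* The two expeditions see X_0, ..., X_(n-1) and X_n, ..., X_(n+m-1). *)
Definition first_sample (w : Omega) : seq {fset S} :=
  [seq X i w | i <- iota 0 (n w)].

Definition second_sample (w : Omega) : seq {fset S} :=
  [seq X i w | i <- iota (n w) (m w)].

(* The argument [0%N] of [poisson_prob] is a dummy: the library's definition
   does not depend on it. *)
Record poissonized_sampling (mu : probability {fset S} R) (t t' : R) : Prop := {
  law_sample : forall i, distribution P (X i) = mu :> (set {fset S} -> \bar R) ;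
  law_first_size : distribution P n = poisson_prob t 0%N :> (set nat -> \bar R) ;
  law_second_size :
    distribution P m = poisson_prob t' 0%N :> (set nat -> \bar R) ;
  sampling_independence :
    mutually_independent P (fun k : nat + bool =>
      match k with
      | inl i => g_sigma_algebra_preimage (X i)
      | inr true => g_sigma_algebra_preimage n
      | inr false => g_sigma_algebra_preimage m
      end)
}.

Variables (r c : R).

Definition prediction_error_rv (w : Omega) : R :=
  prediction_error r (first_sample w) (second_sample w).

Definition studentized_error_rv (w : Omega) : R :=
  studentized_error r c (first_sample w) (second_sample w).

Lemma measurable_sample_statistic
    (f : seq {fset S} -> seq {fset S} -> R) :
  measurable_fun [set: Omega] (fun w => f (first_sample w) (second_sample w)).
Proof.
have mXs j k (s : seq {fset S}) :
    measurable [set w | [seq X i w | i <- iota j k] = s].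
  elim: k j s => [|k IHk] j [|A s] /=.
  - rewrite (_ : [set _ | _] = setT) //.
    by apply/seteqP; split.
  - rewrite (_ : [set _ | _] = set0) //.
    by apply/seteqP; split.
  - rewrite (_ : [set _ | _] = set0) //.
    by apply/seteqP; split.
  - rewrite (_ : [set _ | _] = (X j @^-1` [set A]) `&`
        [set w | [seq X i w | i <- iota j.+1 k] = s]); last first.
      by apply/seteqP; split=> w /= [-> ->].
    apply: measurableI; last exact: IHk.
    by rewrite -[X in measurable X]setTI; exact: measurable_funPT.
move=> _ B mB; rewrite setTI.
pose K := (nat * nat * (seq {fset S} * seq {fset S}))%type.
pose F (k : K) : set Omega :=
  if `[< B (f k.2.1 k.2.2) >] then
    ((n @^-1` [set k.1.1]) `&` (m @^-1` [set k.1.2])) `&`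
    ([set w | [seq X i w | i <- iota 0 k.1.1] = k.2.1] `&`
     [set w | [seq X i w | i <- iota k.1.1 k.1.2] = k.2.2])
  else set0.
rewrite (_ : _ @^-1` B = \bigcup_k F k); last first.
  apply/seteqP; split=> [w /= Bw|w [k _]]; last first.
    rewrite /F; case: asboolP => // Bk [[/= nk mk] [xk yk]].
    by rewrite /preimage /= /first_sample /second_sample nk mk xk yk.
  exists ((n w, m w), (first_sample w, second_sample w)) => //.
  by rewrite /F /=; case: asboolP.
apply: countable_bigcupT_measurable => [|k]; first exact: countableP.
rewrite /F; case: ifP => _ //.
by apply: measurableI; apply: measurableI => //;
  rewrite -[X in measurable X]setTI; exact: measurable_funPT.
Qed.

HB.instance Definition _ := isMeasurableFun.Build _ _ _ _ prediction_error_rv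
  (measurable_sample_statistic (prediction_error r)).

HB.instance Definition _ := isMeasurableFun.Build _ _ _ _ studentized_error_rv
  (measurable_sample_statistic (studentized_error r c)).

End expeditions.

(* Main.v *)
Require Import Defs.
From mathcomp Require Import ring lra measurable_realfun.

Set Implicit Arguments.
Unset Strict Implicit.
Unset Printing Implicit Defensive.

Import Order.TTheory GRing.Theory Num.Theory.

Local Open Scope classical_set_scope.
Local Open Scope ring_scope.

(** The prediction error is a sum over species of
      Y_s = (-r)^(N_s) - 1{N_s = N'_s = 0},
    because the term of s is (-r)^(N_s) if s was seen in the first expedition,
    1 if it was seen in the second one only, and 0 if it was never seen.
    Likewise the variance estimator is the sum of V_s = r^(2 N_s) - (-r)^(N_s).
    As a set contains at most one species, Poisson sampling makes the pairs
    (N_s, N'_s) independent with independent Poisson components of means t p_s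
    and r t p_s, where p_s is the probability that an observation contains s.
    Their generating functions give E Y_s = 0 and
      E V_s = E Y_s^2 = exp(-t p_s (1 - r^2)) - exp(-t p_s (1 + r)),
    so V^, the sum of the V_s, is unbiased for the variance v of the error.
    Two facts then give the theorem when v tends to infinity.
    - |Y_s| <= 1, so the sum of the Y_s divided by sqrt v is close to a standard
      normal variable by Lindeberg's replacement argument, with an error of
      order 1 / sqrt v against smooth test functions (lemma [lindeberg]).
    - V_s^2 <= 4 Y_s^2, so V^ has a variance at most 4 v, and V^ / v tends to 1
      in probability (lemma [mean_sum_variance_dist]).
    A sandwich between smooth steps turns them into a bound on the distribution
    function of the studentized error (lemma [studentized_cdf_bound]).

    Independence enters through one identity only
    ([sample_mean_generating]): for |z|, |z'| <= 1, the factor z^(N_s) z'^(N'_s)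
    can be integrated out next to any bounded function of the observations that
    do not contain s. It follows from a Mecke recursion for the abundance of s
    ([poisson_integral_abundance]), and the samples enter through their law, an
    iterated sum of iterated integrals ([integral_samples]).

    There may be infinitely many species, but a finite set of them contains all
    the observed ones with probability close to 1 and carries an arbitrarily
    large variance for large t ([finite_species]); the estimates are made on
    that set. *)

(** * Moments of the standard normal law *)

Section gaussian_moments.
Context {R : realType}.
Notation leb := (@lebesgue_measure R).
Implicit Types (x y z u v w : R).

Definition gauss_pdf : R -> R := normal_pdf 0 1.

Let c0 : R := normal_peak 1.

Let gauss_pdfE z : gauss_pdf z = c0 * expR (- (z ^+ 2 / 2)).
Proof.
rewrite /gauss_pdf normal_pdfE ?oner_eq0// /normal_fun subr0 expr1n.
by rewrite mulNr.
Qed.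

Lemma gauss_pdf_ge0 z : 0 <= gauss_pdf z.
Proof. exact: normal_pdf_ge0. Qed.

Lemma continuous_gauss_pdf : continuous gauss_pdf.
Proof. by apply: continuous_normal_pdf; rewrite oner_eq0. Qed.

Lemma measurable_gauss_pdf : measurable_fun [set: R] gauss_pdf.
Proof. exact: measurable_normal_pdf. Qed.

Lemma gauss_pdfN z : gauss_pdf (- z) = gauss_pdf z.
Proof. by rewrite !gauss_pdfE sqrrN. Qed.

Let is_derive_gauss_pdf z : is_derive z (1 : R) gauss_pdf (- z * gauss_pdf z).
Proof.
rewrite (_ : gauss_pdf = fun z => c0 * expR (- (z ^+ 2 / 2))); last first.
  by apply/funext => y; rewrite gauss_pdfE.
apply: is_derive_eq.
by rewrite /GRing.scale/=; field.
Qed.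

Let is_derive_id_gauss_pdf z :
  is_derive z (1 : R) (fun z => - (z * gauss_pdf z)) ((z ^+ 2 - 1) * gauss_pdf z).
Proof.
have dg := is_derive_gauss_pdf z.
apply: is_derive_eq.
by rewrite /GRing.scale/=; ring.
Qed.

(** A cubic polynomial is at most a multiple of [exp (3 z^2 / 8)], which turns the
    standard normal density into a multiple of the normal density of standard
    deviation 2. *)
Lemma integrable_poly_gauss_pdf (f : R -> R) (C : R) :
  measurable_fun [set: R] f -> (forall z, `|f z| <= C * (1 + `|z| ^+ 3)) ->
  leb.-integrable [set: R] (EFin \o (fun z => f z * gauss_pdf z)).
Proof.
move=> mf fC.
have C0 : 0 <= C.
  have := fC 0; rewrite normr0 expr0n/= addr0 mulr1; exact: le_trans.
have p2 : 0 < normal_peak 2 :> R by apply: normal_peak_gt0; rewrite pnatr_eq0.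
pose K := C * 30 * c0 / normal_peak 2.
apply: (@le_integrable _ _ _ leb setT _ _ (fun z => K%:E * (normal_pdf 0 2 z)%:E)%E) => //=.
- apply/measurable_EFinP; apply: measurable_funM => //.
  exact: measurable_gauss_pdf.
- move=> z _; rewrite /= lee_fin normrM (ger0_norm (gauss_pdf_ge0 z)).
  have c00 : 0 <= c0 := normal_peak_ge0 1.
  have K0 : 0 <= K by apply: divr_ge0; [do 2?apply: mulr_ge0|exact: ltW].
  rewrite [leRHS]ger0_norm ?(mulr_ge0 K0) ?normal_pdf_ge0//.
  rewrite gauss_pdfE normal_pdfE ?pnatr_eq0// /normal_fun subr0.
  have -> : - (z ^+ 2 / 2) = - (3 * z ^+ 2 / 8) + - z ^+ 2 / (2 ^+ 2 *+ 2) :> R.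
    by rewrite -mulr_natr; field.
  rewrite expRD; set e8 := expR (- z ^+ 2 / _); set e := expR _.
  have -> : K * (normal_peak 2 * e8) = C * 30 * (c0 * e8).
    by rewrite /K; field; rewrite gt_eqF.
  have -> : `|f z| * (c0 * (e * e8)) = `|f z| * e * (c0 * e8) by ring.
  rewrite ler_wpM2r ?mulr_ge0 ?expR_ge0//.
  apply: (le_trans (ler_wpM2r (expR_ge0 _) (fC z))).
  rewrite -(mulrA C); apply: ler_wpM2l => //.
  rewrite /e expRN ler_pdivrMr ?expR_gt0//.
  have /(@expR_ge1Dxn R _ 1) : 0 <= 3 * z ^+ 2 / 8.
    by rewrite divr_ge0// mulr_ge0 ?sqr_ge0.
  rewrite (_ : 2`!%:R = 2 :> R)// -[z ^+ 2](real_normK (num_real z)).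
  have := normr_ge0 z; move: `|z| (expR _) => a b a0.
  nra.
- by apply: integrableZl => //; exact: integrable_normal_pdf.
Qed.


Lemma integrable_gauss_pdf : leb.-integrable [set: R] (EFin \o gauss_pdf).
Proof. exact: integrable_normal_pdf. Qed.

Lemma integrable_id_gauss_pdf :
  leb.-integrable [set: R] (EFin \o (fun z => z * gauss_pdf z)).
Proof.
apply: (@integrable_poly_gauss_pdf id 1) => // z.
rewrite mul1r; have := normr_ge0 z; move: `|z| => a a0.
by have := mulr_ge0 a0 (sqr_ge0 (a - 1)); nra.
Qed.

Lemma integrable_sqr_gauss_pdf :
  leb.-integrable [set: R] (EFin \o (fun z => z ^+ 2 * gauss_pdf z)).
Proof.
apply: (@integrable_poly_gauss_pdf (fun z => z ^+ 2) 1) => [|z].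
  exact: measurable_funX.
rewrite mul1r normrX; have := normr_ge0 z; move: `|z| => a a0.
by have := mulr_ge0 a0 (sqr_ge0 (a - 1)); nra.
Qed.

Let cvg_id_gauss_pdf : n%:R * gauss_pdf n%:R @[n --> \oo] --> (0 : R).
Proof.
have c00 : 0 <= c0 := normal_peak_ge0 1.
apply: (@squeeze_cvgr _ _ _ _ (cst 0) (fun n => 4 * c0 * n.+1%:R^-1)).
- near=> n => /=; rewrite mulr_ge0 ?gauss_pdf_ge0//= gauss_pdfE expRN.
  rewrite mulrCA (mulrC 4) -(mulrA c0); apply: ler_wpM2l => //.
  have n1 : 1 <= n%:R :> R by rewrite ler1n; near: n; exact: nbhs_infty_gt.
  rewrite ler_pdivrMr ?expR_gt0// mulrAC ler_pdivlMr ?ltr0n//.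
  have := @expR_ge1Dx R (n%:R ^+ 2 / 2).
  rewrite -[n.+1%:R]natr1; move: (n%:R : R) n1 (expR _) => a a1 e.
  nra.
- exact: cvg_cst.
- rewrite -[X in _ --> X](mulr0 (4 * c0)); apply: cvgMr.
  exact: cvg_harmonic.
Unshelve. all: by end_near. Qed.

Let cvg_oppr_itv (f : R -> R) : leb.-integrable [set: R] (EFin \o f) ->
  \int[leb]_(z in `[- n%:R, n%:R]) f z @[n --> \oo] --> \int[leb]_z f z.
Proof.
move=> intf; have mf : measurable_fun setT f by move/integrableP : intf => -[/measurable_EFinP].
apply: fine_cvg; rewrite fineK; last exact: integrable_fin_num.
have H := @dominated_cvg _ _ _ leb setT measurableT
  (fun n : nat => (EFin \o f) \_ `[- n%:R, n%:R]) (EFin \o f) (abse \o (EFin \o f)).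
under eq_cvg do rewrite integral_mkcond.
apply: H => //.
- by move=> n; apply/(measurable_restrictT _ _).1 => //; apply/measurable_EFinP/measurable_funTS.
- move=> z _; apply: (@cvg_near_cst _ _ _ _ \oo).
  near=> n; rewrite patchE ifT// inE/= in_itv/= -ler_norml.
  by near: n; exact: nbhs_infty_ger.
- exact: integrable_abse.
- move=> n z _; rewrite patchE; case: ifPn => // _.
  rewrite (_ : point = 0%E)// abse0; exact: abse_ge0.
Unshelve. all: by end_near. Qed.

(** The fundamental theorem of calculus on [[-n, n]], passed to the limit. With
    the antiderivatives [- gauss_pdf z] and [- z * gauss_pdf z] it yields the
    first two moments without any computation on half-lines. *)
Lemma Rintegral_antiderivative (f F : R -> R) :
  leb.-integrable [set: R] (EFin \o f) -> continuous f ->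
  (forall z, is_derive z (1 : R) F (f z)) ->
  F n%:R - F (- n%:R) @[n --> \oo] --> 0 ->
  \int[leb]_z f z = 0.
Proof.
move=> intf cf dF F0; apply: (cvg_unique _ (cvg_oppr_itv intf)) => //.
apply: cvg_trans F0; apply: near_eq_cvg; near=> n.
have n0 : 0 < n%:R :> R by rewrite ltr0n; near: n; exact: nbhs_infty_gt.
have cF : continuous F.
  by move=> z; apply: differentiable_continuous; apply/derivable1_diffP.
rewrite /Rintegral (@continuous_FTC2 _ f F)//.
- by rewrite -subr_gt0 opprK addr_gt0.
- exact: continuous_subspaceT.
- split => //.
  + exact/cvg_at_right_filter/cF.
  + exact/cvg_at_left_filter/cF.
- by move=> z _; rewrite derive1E derive_val.
Unshelve. all: by end_near. Qed.

Lemma gauss_mean : \int[leb]_z (z * gauss_pdf z) = 0.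
Proof.
apply: (@Rintegral_antiderivative _ (fun z => - gauss_pdf z)).
- exact: integrable_id_gauss_pdf.
- by move=> z; apply: cvgM; [exact: cvg_id|exact: continuous_gauss_pdf].
- move=> z; have dg := is_derive_gauss_pdf z.
  by apply: is_derive_eq; rewrite mulNr opprK.
- under eq_cvg do rewrite gauss_pdfN subrr.
  exact: cvg_cst.
Qed.

Lemma gauss_variance : \int[leb]_z (z ^+ 2 * gauss_pdf z) = 1.
Proof.
have int2 := integrable_sqr_gauss_pdf; have int0 := integrable_gauss_pdf.
have : \int[leb]_z (z ^+ 2 * gauss_pdf z - gauss_pdf z) = 0.
  apply: (@Rintegral_antiderivative _ (fun z => - (z * gauss_pdf z))).
  - exact: (integrableB _ int2 int0).
  - move=> z; apply: cvgB; last exact: continuous_gauss_pdf.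
    by apply: cvgM; [exact: exprn_continuous|exact: continuous_gauss_pdf].
  - move=> z; rewrite -[X in _ - X]mul1r -mulrBl.
    exact: is_derive_id_gauss_pdf.
  - have : -2 * (n%:R * gauss_pdf n%:R) @[n --> \oo] --> -2 * (0 : R).
      exact: cvgMr.
    rewrite mulr0.
    apply: cvg_trans; apply: near_eq_cvg; near=> n.
    by rewrite gauss_pdfN; ring.
rewrite RintegralB// => /eqP; rewrite subr_eq0 => /eqP ->.
by rewrite /Rintegral integral_normal_pdf.
Unshelve. all: by end_near. Qed.

End gaussian_moments.

(** * The heat semigroup of the normal laws *)

Section gaussian_semigroup.
Context {R : realType}.
Notation leb := (@lebesgue_measure R).
Implicit Types (x y z u v w a b : R) (h : R -> R).

(** The heat semigroup: the mean of [h] under the normal law of mean [x] and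
    variance [v]. *)
Definition gauss_smooth h v x : R :=
  \int[leb]_z (h (x + Num.sqrt v * z) * gauss_pdf z).

Let gauss_integral_affine h a b : 0 < a ->
  continuous h -> (forall x, 0 <= h x) ->
  (\int[leb]_z (h (b + a * z) * gauss_pdf z)%:E =
   \int[leb]_u (h u * (gauss_pdf ((u - b) / a) / a))%:E)%E.
Proof.
move=> a0 ch h0.
have dF : derive1 (fun u : R => (u - b) / a) = cst a^-1.
  by apply/funext => u; rewrite derive1E derive_val /GRing.scale/=; field; rewrite gt_eqF.
rewrite (@increasing_ge0_integration_by_substitutionT _ (fun u => (u - b) / a)) ?dF//.
- apply: eq_integral => u _; congr EFin.
  rewrite /= (_ : (_ * _)%R u = (h (b + a * ((u - b) / a)) * gauss_pdf ((u - b) / a)) * a^-1)//.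
  by rewrite mulrCA divff ?gt_eqF// mulr1 addrC subrK mulrA.
- by move=> x y xy; rewrite ltr_pM2r ?invr_gt0// ltrD2r.
- by move=> ?; exact: cvg_cst.
- exact: is_cvg_cst.
- exact: is_cvg_cst.
- apply/gt0_cvgMlNy; last exact: cvg_addrr_Ny.
  by rewrite invr_gt0.
- apply/gt0_cvgMly; last exact: cvg_addrr.
  by rewrite invr_gt0.
- move=> z; apply: cvgM; last exact: continuous_gauss_pdf.
  apply: continuous_comp; last exact: ch.
  by apply: cvgD; [exact: cvg_cst|apply: cvgMr; exact: cvg_id].
- by move=> z; rewrite mulr_ge0// gauss_pdf_ge0.
Qed.

(* Completing the square: the product of the density of [x + sqrt v z + sqrt w y]
   given [z] with that of [z] is the density of the sum times the conditional
   density of [z] given the sum. *)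
Let gauss_pdf_mul u x z v w : 0 <= v -> 0 < w ->
  gauss_pdf ((u - (x + Num.sqrt v * z)) / Num.sqrt w) / Num.sqrt w * gauss_pdf z =
  gauss_pdf ((u - x) / Num.sqrt (v + w)) / Num.sqrt (v + w) *
  normal_pdf (Num.sqrt v * (u - x) / (v + w)) (Num.sqrt w / Num.sqrt (v + w)) z.
Proof.
move=> v0 w0; have vw0 : 0 < v + w by rewrite ltr_wpDl.
have sw0 : 0 < Num.sqrt w by rewrite sqrtr_gt0.
have svw0 : 0 < Num.sqrt (v + w) by rewrite sqrtr_gt0.
have peakE a : 0 < a -> normal_peak a = normal_peak 1 / a :> R.
  move=> a0; rewrite /normal_peak -mulrnAr sqrtrM ?sqr_ge0// sqrtr_sqr gtr0_norm//.
  by rewrite expr1n mul1r invfM mulrC.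
rewrite /gauss_pdf !normal_pdfE ?oner_eq0 ?gt_eqF ?divr_gt0//.
rewrite (peakE (_ / _)) ?divr_gt0// /normal_fun.
set p := normal_peak 1; set q := Num.sqrt v; set s := Num.sqrt (v + w).
set t := Num.sqrt w.
have q2 : q ^+ 2 = v by rewrite sqr_sqrtr.
have s2 : s ^+ 2 = v + w by rewrite sqr_sqrtr// ltW.
have t2 : t ^+ 2 = w by rewrite sqr_sqrtr// ltW.
transitivity (p * p / t * expR (- ((u - (x + q * z)) / t - 0) ^+ 2 / (1 ^+ 2 *+ 2)
   + - (z - 0) ^+ 2 / (1 ^+ 2 *+ 2))).
  by rewrite expRD; ring.
transitivity (p * p / t * expR (- ((u - x) / s - 0) ^+ 2 / (1 ^+ 2 *+ 2) +
   - (z - q * (u - x) / (v + w)) ^+ 2 / ((t / s) ^+ 2 *+ 2))); last first.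
  by rewrite expRD; field; rewrite !gt_eqF.
congr (_ * expR _); rewrite !subr0 !expr1n -(mulr_natr ((t / s) ^+ 2)).
rewrite [(t / s) ^+ 2]expr_div_n [((u - x) / s) ^+ 2]expr_div_n s2 -q2 -t2.
by field; rewrite t2 q2 !gt_eqF.
Qed.

Lemma gauss_smooth0 h x : measurable_fun [set: R] h -> gauss_smooth h 0 x = h x.
Proof.
move=> mh; rewrite /gauss_smooth sqrtr0.
under eq_Rintegral do rewrite mul0r addr0.
rewrite RintegralZl//; last exact: integrable_normal_pdf.
by rewrite /Rintegral integral_normal_pdf mulr1.
Qed.

Section bounded.
Variable h : R -> R.
Hypotheses (ch : continuous h) (h01 : forall x, 0 <= h x <= 1).

Let h_ge0 x : 0 <= h x. Proof. by case/andP: (h01 x). Qed.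

Let mh : measurable_fun [set: R] h.
Proof. exact: continuous_measurable_fun. Qed.

Let measurable_arg v x : measurable_fun [set: R] (fun z => h (x + Num.sqrt v * z)).
Proof.
by apply: measurableT_comp => //; apply: measurable_funD.
Qed.

Let integrable_arg v x : leb.-integrable [set: R]
  (EFin \o (fun z => h (x + Num.sqrt v * z) * gauss_pdf z)).
Proof.
apply: (@integrable_poly_gauss_pdf _ _ 1) => // z.
rewrite mul1r ger0_norm//; have /andP[_ h1] := h01 (x + Num.sqrt v * z).
by apply: le_trans h1 _; rewrite lerDl exprn_ge0.
Qed.

Let gauss_smoothE v x :
  (gauss_smooth h v x)%:E = (\int[leb]_z (h (x + Num.sqrt v * z) * gauss_pdf z)%:E)%E.
Proof.
rewrite /gauss_smooth /Rintegral fineK//.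
exact: (integrable_fin_num _ (integrable_arg v x)).
Qed.

Lemma gauss_smooth_ge0 v x : 0 <= gauss_smooth h v x.
Proof. by apply: Rintegral_ge0 => z _; rewrite mulr_ge0// gauss_pdf_ge0. Qed.

Lemma gauss_smooth_le1 v x : gauss_smooth h v x <= 1.
Proof.
rewrite -lee_fin gauss_smoothE -(integral_normal_pdf 0 1).
apply: ge0_le_integral => //.
- by move=> z _; rewrite lee_fin mulr_ge0// gauss_pdf_ge0.
- apply/measurable_EFinP; apply: measurable_funM; first exact: measurable_arg.
  exact: measurable_gauss_pdf.
- by apply/measurable_EFinP; exact: measurable_gauss_pdf.
- move=> z _; rewrite lee_fin -[leRHS]mul1r ler_wpM2r ?gauss_pdf_ge0//.
  by case/andP: (h01 (x + Num.sqrt v * z)).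
Qed.

(** A sum of two independent centred normal variables is normal: once the
    inner variable is shifted into the density, the square is completed
    and the outer variable integrates out. *)
Lemma gauss_smooth_semigroup v w x : 0 <= v -> 0 <= w ->
  gauss_smooth (gauss_smooth h w) v x = gauss_smooth h (v + w) x.
Proof.
move=> v0; rewrite le_eqVlt => /predU1P[<-|w0].
  rewrite addr0 /gauss_smooth; apply: eq_Rintegral => z _.
  by rewrite -/(gauss_smooth h 0 _) gauss_smooth0.
have vw0 : 0 < v + w by rewrite ltr_wpDl.
have sw0 : 0 < Num.sqrt w by rewrite sqrtr_gt0.
have svw0 : 0 < Num.sqrt (v + w) by rewrite sqrtr_gt0.
pose g z u := h u * (gauss_pdf ((u - (x + Num.sqrt v * z)) / Num.sqrt w) / Num.sqrt w)
  * gauss_pdf z.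
have g0 z u : 0 <= g z u by rewrite !mulr_ge0 ?gauss_pdf_ge0 ?invr_ge0// ltW.
have mg : measurable_fun [set: R * R] (fun p => (g p.1 p.2)%:E).
  apply/measurable_EFinP; apply: measurable_funM; last first.
    exact: measurableT_comp measurable_gauss_pdf _.
  apply: measurable_funM; first exact: measurableT_comp.
  apply: measurable_funM => //; apply: measurableT_comp measurable_gauss_pdf _.
  apply: measurable_funM => //; apply: measurable_funB => //.
  by apply: measurable_funD => //; exact: measurable_funM.
rewrite {1}/gauss_smooth; apply: (congr1 fine (y := (gauss_smooth h (v + w) x)%:E)).
rewrite gauss_smoothE (gauss_integral_affine x svw0 ch h_ge0).
transitivity (\int[leb]_z \int[leb]_u (g z u)%:E)%E.
  apply: eq_integral => z _.
  rewrite EFinM gauss_smoothE (gauss_integral_affine _ sw0 ch h_ge0).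
  rewrite -ge0_integralZr//.
  - apply/measurable_EFinP; apply: measurable_funM => //.
    apply: measurable_funM => //; apply: measurableT_comp measurable_gauss_pdf _.
    by apply: measurable_funM => //; exact: measurable_funB.
  - by move=> u _; rewrite lee_fin !mulr_ge0 ?gauss_pdf_ge0 ?invr_ge0// ltW.
  - by rewrite lee_fin gauss_pdf_ge0.
rewrite [LHS](@fubini_tonelli _ _ _ _ _ leb leb (fun p => (g p.1 p.2)%:E))//=; last first.
  by move=> p; rewrite lee_fin.
apply: eq_integral => u _.
under eq_integral do rewrite /g -mulrA gauss_pdf_mul// mulrA EFinM.
rewrite ge0_integralZl//.
- by rewrite integral_normal_pdf mule1.
- by apply/measurable_EFinP; exact: measurable_normal_pdf.
- by move=> z _; rewrite lee_fin normal_pdf_ge0.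
- by rewrite lee_fin !mulr_ge0 ?gauss_pdf_ge0 ?invr_ge0// ltW.
Qed.

End bounded.

(** [h1] and [h2] play the part of the first two derivatives of [h]. Stated without
    derivatives, the expansion is preserved when [h] is averaged over translates,
    with no differentiation under the integral sign. *)
Definition cubic_taylor (M : R) h h1 h2 := forall x y,
  `|h (x + y) - h x - y * h1 x - y ^+ 2 / 2 * h2 x| <= M * `|y| ^+ 3.

Let integrable_bounded h B v x :
  measurable_fun [set: R] h -> (forall x, `|h x| <= B) ->
  leb.-integrable [set: R] (EFin \o (fun z => h (x + Num.sqrt v * z) * gauss_pdf z)).
Proof.
move=> mh hB; apply: (@integrable_poly_gauss_pdf _ _ B) => [|z].
  by apply: measurableT_comp => //; apply: measurable_funD.
have B0 : 0 <= B by apply: le_trans (hB 0).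
by apply: (le_trans (hB _)); rewrite ler_peMr// lerDl exprn_ge0.
Qed.

Lemma gauss_smooth_bounded h B v x :
  measurable_fun [set: R] h -> (forall x, `|h x| <= B) -> `|gauss_smooth h v x| <= B.
Proof.
move=> mh hB; have ih := integrable_bounded v x mh hB.
have ip := @integrable_gauss_pdf R.
apply: le_trans (le_normr_Rintegral _ ih) _ => //.
rewrite -[leRHS]mulr1 -(_ : \int[leb]_z gauss_pdf z = 1); last first.
  by rewrite /Rintegral integral_normal_pdf.
rewrite -RintegralZl//; apply: le_Rintegral => //.
- exact: (integrable_norm ih).
- exact: (integrableZl _ B ip).
- by move=> z _; rewrite normrM (ger0_norm (gauss_pdf_ge0 _)) ler_wpM2r ?gauss_pdf_ge0.
Qed.

Lemma cubic_taylor_gauss_smooth M B h h1 h2 w :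
  measurable_fun [set: R] h -> measurable_fun [set: R] h1 ->
  measurable_fun [set: R] h2 ->
  (forall x, `|h x| <= B) -> (forall x, `|h1 x| <= B) -> (forall x, `|h2 x| <= B) ->
  cubic_taylor M h h1 h2 ->
  cubic_taylor M (gauss_smooth h w) (gauss_smooth h1 w) (gauss_smooth h2 w).
Proof.
move=> mh mh1 mh2 hB hB1 hB2 th x y.
have ih := integrable_bounded w _ mh hB.
have ih1 := integrable_bounded w _ mh1 hB1.
have ih2 := integrable_bounded w _ mh2 hB2.
rewrite {1 2}/gauss_smooth -RintegralB//.
rewrite /gauss_smooth -!RintegralZl// -RintegralB//; last 2 first.
- exact: (integrableB _ (ih _) (ih _)).
- exact: (integrableZl _ _ (ih1 _)).
rewrite -RintegralB//; last 2 first.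
- exact: (integrableB _ (integrableB _ (ih _) (ih _)) (integrableZl _ _ (ih1 _))).
- exact: (integrableZl _ _ (ih2 _)).
set D := (X in `|Rintegral _ _ X|).
have iD : leb.-integrable [set: R] (EFin \o D) := integrableB measurableT
  (integrableB measurableT (integrableB measurableT (ih (x + y)) (ih x))
    (integrableZl measurableT y (ih1 x)))
  (integrableZl measurableT (y ^+ 2 / 2) (ih2 x)).
apply: le_trans (le_normr_Rintegral _ iD) _ => //.
rewrite -[leRHS]mulr1 -(_ : \int[leb]_z gauss_pdf z = 1); last first.
  by rewrite /Rintegral integral_normal_pdf.
rewrite -RintegralZl//; last exact: integrable_normal_pdf.
apply: le_Rintegral => //.
- exact: (integrable_norm iD).
- apply: (integrableZl _ (M * `|y| ^+ 3) (integrable_normal_pdf _ _)) => //.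
- move=> z _; set q := Num.sqrt w * z.
  rewrite (_ : D z = (h (x + q + y) - h (x + q) - y * h1 (x + q) -
      y ^+ 2 / 2 * h2 (x + q)) * gauss_pdf z); last first.
    by rewrite /D -/q (addrAC x y); ring.
  rewrite normrM (ger0_norm (gauss_pdf_ge0 _)) ler_wpM2r ?gauss_pdf_ge0//.
Qed.

Definition gauss_abs3 : R := \int[leb]_z (`|z| ^+ 3 * gauss_pdf z).

Lemma gauss_abs3_ge0 : 0 <= gauss_abs3.
Proof. by apply: Rintegral_ge0 => z _; rewrite mulr_ge0 ?exprn_ge0 ?gauss_pdf_ge0. Qed.

(** Integrating the expansion of [h] leaves only the quadratic term, as the mean is
    zero and the variance is [v]. *)
Lemma gauss_smooth_taylor M B h h1 h2 v x : 0 <= v ->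
  measurable_fun [set: R] h -> (forall x, `|h x| <= B) ->
  cubic_taylor M h h1 h2 ->
  `|gauss_smooth h v x - h x - v / 2 * h2 x| <= M * gauss_abs3 * Num.sqrt v ^+ 3.
Proof.
move=> v0 mh hB th.
have [B0 M0] : 0 <= B /\ 0 <= M.
  split; first exact: le_trans (hB 0).
  by have := le_trans (normr_ge0 _) (th 0 1); rewrite normr1 expr1n mulr1.
have ih := integrable_bounded v x mh hB.
have ip := @integrable_gauss_pdf R; have i1 := @integrable_id_gauss_pdf R.
have i2 := @integrable_sqr_gauss_pdf R.
have i3 : leb.-integrable [set: R] (EFin \o (fun z => `|z| ^+ 3 * gauss_pdf z)).
  apply: (@integrable_poly_gauss_pdf _ (fun z => `|z| ^+ 3) 1) => [|z].
    by apply: measurable_funX; exact: normr_measurable.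
  by rewrite mul1r ger0_norm ?exprn_ge0// lerDr.
set q := Num.sqrt v; have q0 : 0 <= q by rewrite sqrtr_ge0.
pose E z := h (x + q * z) * gauss_pdf z - h x * gauss_pdf z -
  q * h1 x * (z * gauss_pdf z) - v / 2 * h2 x * (z ^+ 2 * gauss_pdf z).
have iE : leb.-integrable [set: R] (EFin \o E).
  exact: (integrableB _ (integrableB _ (integrableB _ ih (integrableZl _ (h x) ip))
    (integrableZl _ (q * h1 x) i1)) (integrableZl _ (v / 2 * h2 x) i2)).
have -> : gauss_smooth h v x - h x - v / 2 * h2 x = \int[leb]_z E z.
  rewrite /E RintegralB//; last 2 first.
  - exact: (integrableB _ (integrableB _ ih (integrableZl _ (h x) ip))
      (integrableZl _ (q * h1 x) i1)).
  - exact: (integrableZl _ (v / 2 * h2 x) i2).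
  rewrite RintegralB//; last 2 first.
  - exact: (integrableB _ ih (integrableZl _ (h x) ip)).
  - exact: (integrableZl _ (q * h1 x) i1).
  rewrite RintegralB//; last exact: (integrableZl _ (h x) ip).
  rewrite !RintegralZl// gauss_mean gauss_variance mulr0 subr0 mulr1.
  by rewrite [X in h x * X]/Rintegral integral_normal_pdf mulr1.
apply: le_trans (le_normr_Rintegral _ iE) _ => //.
rewrite mulrAC -RintegralZl//; apply: le_Rintegral => //.
- exact: (integrable_norm iE).
- exact: (integrableZl _ (M * q ^+ 3) i3).
- move=> z _; rewrite [leRHS]mulrA.
  rewrite (_ : E z = (h (x + q * z) - h x - q * z * h1 x -
      (q * z) ^+ 2 / 2 * h2 x) * gauss_pdf z); last first.
    by rewrite /E -(sqr_sqrtr v0) -/q; field.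
  rewrite normrM (ger0_norm (gauss_pdf_ge0 _)) ler_wpM2r ?gauss_pdf_ge0//.
  by apply: le_trans (th x (q * z)) _; rewrite normrM (ger0_norm q0) exprMn mulrA.
Qed.

End gaussian_semigroup.

(** * A smooth step function *)

Section smooth_step.
Context {R : realType}.
Implicit Types (x y a b : R) (h : R -> R).

Lemma cubic_taylor_continuous M h h1 h2 : cubic_taylor M h h1 h2 -> continuous h.
Proof.
move=> th x; apply/cvgrPdist_lt => e e0.
pose C := `|h1 x| + `|h2 x| + `|M| + 1.
have C0 : 0 < C by rewrite ltr_pwDr// !addr_ge0.
near=> z.
have zx1 : `|x - z| < 1 by near: z; apply: cvgr_dist_lt.
have zxe : `|x - z| < e / C by near: z; apply: cvgr_dist_lt; rewrite ?divr_gt0.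
have := th x (z - x); rewrite (addrC x) subrK.
set y := z - x => H; rewrite distrC.
have y1 : `|y| <= 1 by rewrite /y distrC ltW.
have ye : C * `|y| < e by rewrite mulrC -ltr_pdivlMr// /y distrC.
apply: le_lt_trans ye.
rewrite (_ : h z - h x = (h z - h x - y * h1 x - y ^+ 2 / 2 * h2 x) + y * h1 x
  + y ^+ 2 / 2 * h2 x); last by ring.
apply: le_trans (ler_normD _ _) _; apply: le_trans (lerD (ler_normD _ _) (lexx _)) _.
apply: le_trans (lerD (lerD H (lexx _)) (lexx _)) _.
rewrite !normrM -(expr2 `|y|) (ger0_norm (_ : 0 <= 2^-1 :> R))// ?invr_ge0//.
have h10 := normr_ge0 (h1 x); have h20 := normr_ge0 (h2 x); rewrite /C.
have y0 := normr_ge0 y; have MM := ler_norm M; have M0 := normr_ge0 M.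
move: `|y| `|h1 x| `|h2 x| `|M| h10 h20 y0 y1 MM M0 => {H} t p q m p0 q0 t0 t1 Mm m0.
have t3 : t ^+ 3 <= t by rewrite exprS ler_piMr// exprn_ile1.
have t2 : t ^+ 2 <= t by rewrite exprS ler_piMr// exprn_ile1.
have t30 : 0 <= t ^+ 3 by rewrite exprn_ge0.
have : M * t ^+ 3 <= m * t by rewrite (le_trans (ler_wpM2r _ Mm))// ler_wpM2l.
have : t ^+ 2 / 2 * q <= q * t by nra.
nra.
Unshelve. all: by end_near. Qed.

Lemma cubic_taylor_affine M h h1 h2 a b : 0 <= a -> cubic_taylor M h h1 h2 ->
  cubic_taylor (M * a ^+ 3) (fun x => h (a * x + b)) (fun x => a * h1 (a * x + b))
    (fun x => a ^+ 2 * h2 (a * x + b)).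
Proof.
move=> a0 th x y; have := th (a * x + b) (a * y).
rewrite normrM (ger0_norm a0) exprMn mulrA mulrDr (addrAC _ b).
congr (`| _ | <= _); by ring.
Qed.

Let p x : R := Num.max 0 x.
Let q x : R := p x ^+ 3.
Let q1 x : R := 3 * p x ^+ 2.
Let q2 x : R := 6 * p x.

(* The only expansion computed by cases; the one of [step] is a combination of
   translates of it. *)
Let cubic_taylor_pospart : cubic_taylor 2 q q1 q2.
Proof.
move=> x y; rewrite /q /q1 /q2 /p.
have y3 := exprn_ge0 3 (normr_ge0 y).
have [x0|x0] := leP 0 x; have [xy0|xy0] := leP 0 (x + y).
- rewrite (_ : _ - _ = y ^+ 3); last by field.
  by rewrite normrX ler_peMl// ler1n.
- rewrite (_ : _ - _ = y ^+ 3 - (x + y) ^+ 3); last by field.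
  apply: le_trans (ler_normB _ _) _; rewrite !normrX mulr2n mulrDl mul1r lerD2l.
  rewrite lerXn2r ?nnegrE// !ltr0_norm//; nra.
- rewrite (_ : _ - _ = (x + y) ^+ 3); last by field.
  rewrite normrX (@le_trans _ _ (`|y| ^+ 3))// ?ler_peMl// ?ler1n//.
  rewrite lerXn2r ?nnegrE// !ger0_norm//; nra.
- rewrite (_ : _ - _ = 0); last by field.
  by rewrite normr0 mulr_ge0.
Qed.

(** A decreasing step of class C^2 from 1 to 0 over [[0, 3]]: one minus the integral
    of the quadratic B-spline. Its third derivative is piecewise constant, hence
    bounded, which is all the smoothness that the replacement argument asks for. *)
Definition step x : R := 1 - (q x - 3 * q (x - 1) + 3 * q (x - 2) - q (x - 3)) / 6.
Definition step1 x : R := - (q1 x - 3 * q1 (x - 1) + 3 * q1 (x - 2) - q1 (x - 3)) / 6.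
Definition step2 x : R := - (q2 x - 3 * q2 (x - 1) + 3 * q2 (x - 2) - q2 (x - 3)) / 6.

Lemma cubic_taylor_step : cubic_taylor 3 step step1 step2.
Proof.
move=> x y.
pose e z := q (z + y) - q z - y * q1 z - y ^+ 2 / 2 * q2 z.
have t0 := exprn_ge0 3 (normr_ge0 y).
have H z : `|e z| <= 2 * `|y| ^+ 3 := cubic_taylor_pospart z y.
have := H x; have := H (x - 1); have := H (x - 2); have := H (x - 3).
rewrite (_ : step (x + y) - _ - _ - _ =
    - (e x - 3 * e (x - 1) + 3 * e (x - 2) - e (x - 3)) / 6); last first.
  by rewrite /e /step /step1 /step2 !(addrAC x y); field.
move: (e x) (e (x - 1)) (e (x - 2)) (e (x - 3)) => e0 e1 e2 e3.
move: {H} (`|y| ^+ 3) t0 => t t0.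
move=> /ler_normlP[? ?] /ler_normlP[? ?] /ler_normlP[? ?] /ler_normlP[? ?].
by apply/ler_normlP; split; lra.
Qed.

Lemma step_bounds x : [/\ 0 <= step x <= 1, `|step1 x| <= 1 & `|step2 x| <= 1].
Proof.
have pE0 (z : R) : z <= 0 -> p z = 0 by move=> z0; rewrite /p max_l.
have pE (z : R) : 0 <= z -> p z = z by move=> z0; rewrite /p max_r.
(* On each interval between consecutive knots, the bounds are linear in the
   powers of the local coordinate and in these expressions. *)
have hint (t : R) : 0 <= t <= 1 -> [/\ 0 <= t ^+ 3 <= t ^+ 2, t ^+ 2 <= t,
    0 <= (1 - t) ^+ 2 * (1 + 2 * t) & 0 <= (1 - t) ^+ 3].
  move=> /andP[t0 t1]; split.
  - rewrite exprn_ge0//= exprS; have := sqr_ge0 t; nra.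
  - by rewrite expr2 ler_piMl.
  - by rewrite mulr_ge0 ?sqr_ge0// addr_ge0// mulr_ge0.
  - by rewrite exprn_ge0// subr_ge0.
have [x0|x0] := leP x 0.
  rewrite /step /step1 /step2 /q /q1 /q2 !pE0; [|lra..].
  by rewrite !expr0n/= !(mulr0, subr0, addr0, oppr0, mul0r) normr0 ler01 lexx.
have [x3|x3] := leP 3 x.
  rewrite /step /step1 /step2 /q /q1 /q2 !pE; [|lra..].
  by split; [apply/andP; split|apply/ler_normlP; split..]; lra.
rewrite /step /step1 /step2 /q /q1 /q2.
have [x1|x1] := leP x 1.
  rewrite (pE x) ?(pE0 (x - 1)) ?(pE0 (x - 2)) ?(pE0 (x - 3)); [|lra..].
  have /hint[/andP[? ?] ? ? ?] : 0 <= x <= 1 by rewrite (ltW x0).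
  rewrite !expr0n/=.
  by split; [apply/andP; split|apply/ler_normlP; split..]; lra.
have [x2|x2] := leP x 2.
  rewrite (pE x) ?(pE (x - 1)) ?(pE0 (x - 2)) ?(pE0 (x - 3)); [|lra..].
  have /hint : 0 <= x - 1 <= 1 by apply/andP; split; lra.
  move=> [/andP[? ?] ? ? ?].
  rewrite !expr0n/=.
  by split; [apply/andP; split|apply/ler_normlP; split..]; lra.
rewrite (pE x) ?(pE (x - 1)) ?(pE (x - 2)) ?(pE0 (x - 3)); [|lra..].
have /hint : 0 <= x - 2 <= 1 by apply/andP; split; lra.
move=> [/andP[? ?] ? ? ?].
rewrite !expr0n/=.
by split; [apply/andP; split|apply/ler_normlP; split..]; lra.
Qed.

Lemma step_eq1 x : x <= 0 -> step x = 1.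
Proof.
move=> x0; rewrite /step /q /p !max_l ?expr0n/=; [by field|lra..].
Qed.

Lemma step_eq0 x : 3 <= x -> step x = 0.
Proof.
move=> x0; rewrite /step /q /p !max_r; [by field|lra..].
Qed.

Lemma measurable_step : [/\ measurable_fun [set: R] step,
  measurable_fun [set: R] step1 & measurable_fun [set: R] step2].
Proof.
have mp : measurable_fun [set: R] p by apply: measurable_maxr.
have mcomb (k : R -> R) : measurable_fun [set: R] k ->
    measurable_fun [set: R] (fun x => k x - 3 * k (x - 1) + 3 * k (x - 2) - k (x - 3)).
  move=> mk; have mkc c : measurable_fun [set: R] (fun x => k (x - c)).
    by apply: measurableT_comp => //; exact: measurable_funB.
  apply: measurable_funB => //; apply: measurable_funD; last exact: measurable_funM.
  by apply: measurable_funB => //; exact: measurable_funM.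
split; first apply: measurable_funB => //; apply: measurable_funM => //;
  try apply: measurableT_comp => //; apply: mcomb.
- exact: measurable_funX.
- by apply: measurable_funM => //; exact: measurable_funX.
- exact: measurable_funM.
Qed.

End smooth_step.

(** * The Lindeberg replacement argument *)

Section mean.
Context {R : realType} {W : Type}.
Implicit Types (f g : W -> R) (a C : R).

Definition bounded_fct f := exists C, forall w, `|f w| <= C.

(** A normalized positive linear functional on the bounded functions, that is
    an expectation stripped of measurability. The arguments below apply it to
    functions of the samples, which are all measurable. *)
Record mean_functional (L : (W -> R) -> R) : Prop := {
  mean_linear : forall a f g, bounded_fct f -> bounded_fct g ->
    L (fun w => a * f w + g w) = a * L f + L g ;
  mean_le : forall f g, bounded_fct f -> bounded_fct g ->
    (forall w, f w <= g w) -> L f <= L g ;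
  mean_one : L (fun=> 1) = 1
}.

Lemma bounded_cst C : bounded_fct (fun=> C).
Proof. by exists `|C|. Qed.

Lemma boundedD f g : bounded_fct f -> bounded_fct g ->
  bounded_fct (fun w => f w + g w).
Proof.
move=> [C Cf] [C' Cg]; exists (C + C') => w.
by rewrite (le_trans (ler_normD _ _))// lerD.
Qed.

Lemma boundedM f g : bounded_fct f -> bounded_fct g ->
  bounded_fct (fun w => f w * g w).
Proof.
move=> [C Cf] [C' Cg]; exists (C * C') => w.
by rewrite normrM ler_pM.
Qed.

Lemma boundedN f : bounded_fct f -> bounded_fct (fun w => - f w).
Proof. by move=> [C Cf]; exists C => w; rewrite normrN. Qed.

Lemma boundedB f g : bounded_fct f -> bounded_fct g ->
  bounded_fct (fun w => f w - g w).
Proof. by move=> bf bg; apply: boundedD => //; exact: boundedN. Qed.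

Lemma boundedX f n : bounded_fct f -> bounded_fct (fun w => f w ^+ n).
Proof.
move=> bf; elim: n => [|n IHn]; first exact: bounded_cst.
by under eq_fun do rewrite exprS; exact: boundedM.
Qed.

Lemma bounded_sum I (s : seq I) (F : I -> W -> R) :
  (forall i, bounded_fct (F i)) -> bounded_fct (fun w => \sum_(i <- s) F i w).
Proof.
move=> bF; elim: s => [|i s IHs].
  by under eq_fun do rewrite big_nil; exact: bounded_cst.
by under eq_fun do rewrite big_cons; exact: boundedD.
Qed.

Variable L : (W -> R) -> R.
Hypothesis mL : mean_functional L.

Lemma meanZ a f : bounded_fct f -> L (fun w => a * f w) = a * L f.
Proof.
move=> bf; have b0 := bounded_cst 0.
have L0 : L (fun=> 0) = 0.
  have := mean_linear mL 1 b0 b0; rewrite mul1r addr0 mul1r => /eqP.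
  by rewrite eq_sym -subr_eq0 addrK => /eqP.
by rewrite -[RHS]addr0 -L0 -(mean_linear mL)//; congr L; apply/funext => w; rewrite addr0.
Qed.

Lemma meanD f g : bounded_fct f -> bounded_fct g ->
  L (fun w => f w + g w) = L f + L g.
Proof.
move=> bf bg; rewrite -[L f]mul1r -(mean_linear mL)//.
by congr L; apply/funext => w; rewrite mul1r.
Qed.

Lemma meanB f g : bounded_fct f -> bounded_fct g ->
  L (fun w => f w - g w) = L f - L g.
Proof.
move=> bf bg; rewrite addrC -mulN1r -(mean_linear mL)//.
by congr L; apply/funext => w; rewrite mulN1r addrC.
Qed.

Lemma mean_cst a : L (fun=> a) = a.
Proof.
rewrite -[RHS]mulr1 -(mean_one mL) -meanZ; last exact: bounded_cst.
by congr L; apply/funext => w; rewrite mulr1.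
Qed.

Lemma mean_dist f g k : bounded_fct f -> bounded_fct g -> bounded_fct k ->
  (forall w, `|f w - g w| <= k w) -> `|L f - L g| <= L k.
Proof.
move=> bf bg bk fgk; rewrite -meanB//; apply/ler_normlP; split.
- rewrite -mulN1r -meanZ; last exact: boundedB.
  apply: (mean_le mL) => //; first by apply: boundedM; [exact: bounded_cst|exact: boundedB].
  by move=> w; rewrite mulN1r; have /ler_normlP[] := fgk w.
- apply: (mean_le mL) => //; first exact: boundedB.
  by move=> w; have /ler_normlP[] := fgk w.
Qed.

End mean.

Section lindeberg.
Context {R : realType} {W : Type} (L : (W -> R) -> R) (mL : mean_functional L).
Context {I : eqType} (Y : I -> W -> R) (v : I -> R).

Hypothesis Y1 : forall i w, `|Y i w| <= 1.
Hypothesis v01 : forall i, 0 <= v i <= 1.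

(** All the independence that the replacement argument consumes: the first two
    moments of one summand do not see the sum of others. *)
Hypothesis mean_rest : forall i (s : seq I), uniq (i :: s) ->
  forall k : R -> R, bounded_fct k ->
  L (fun w => Y i w * k (\sum_(j <- s) Y j w)) = 0 /\
  L (fun w => Y i w ^+ 2 * k (\sum_(j <- s) Y j w)) =
    v i * L (fun w => k (\sum_(j <- s) Y j w)).

Variables (M B : R) (h h1 h2 : R -> R).
Hypotheses (th : cubic_taylor M h h1 h2) (h01 : forall x, 0 <= h x <= 1).
Hypotheses (mh : measurable_fun [set: R] h) (mh1 : measurable_fun [set: R] h1)
  (mh2 : measurable_fun [set: R] h2).
Hypotheses (h1B : forall x, `|h1 x| <= B) (h2B : forall x, `|h2 x| <= B).

Let M0 : 0 <= M.
Proof. by have := le_trans (normr_ge0 _) (th 0 1); rewrite normr1 expr1n mulr1. Qed.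

Let ch : continuous h. Proof. exact: cubic_taylor_continuous th. Qed.

Let lindeberg_step u i s : 0 <= u -> uniq (i :: s) ->
  `|L (fun w => gauss_smooth h u (\sum_(j <- i :: s) Y j w)) -
    L (fun w => gauss_smooth h (v i + u) (\sum_(j <- s) Y j w))|
    <= M * (1 + gauss_abs3) * v i.
Proof.
move=> u0 us; have /andP[v0 v1] := v01 i.
pose S w := \sum_(j <- s) Y j w; pose g := gauss_smooth h u.
pose g1 := gauss_smooth h1 u; pose g2 := gauss_smooth h2 u.
have hB x : `|h x| <= Num.max 1 B.
  by have /andP[h0 hle] := h01 x; rewrite ger0_norm// le_max hle.
have h1B' x : `|h1 x| <= Num.max 1 B by rewrite le_max h1B orbT.
have h2B' x : `|h2 x| <= Num.max 1 B by rewrite le_max h2B orbT.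
have tg : cubic_taylor M g g1 g2 :=
  cubic_taylor_gauss_smooth u mh mh1 mh2 hB h1B' h2B' th.
have g01 x : 0 <= g x <= 1 by rewrite gauss_smooth_ge0 ?gauss_smooth_le1.
have bg : bounded_fct g by exists 1 => x; have /andP[? ?] := g01 x; rewrite ger0_norm.
have [bg1 bg2] : bounded_fct g1 /\ bounded_fct g2.
  by split; exists (Num.max 1 B) => x; exact: gauss_smooth_bounded.
have bS (k : R -> R) : bounded_fct k -> bounded_fct (fun w => k (S w)).
  by move=> [C kC]; exists C.
have bY : bounded_fct (Y i) by exists 1.
have bY2 : bounded_fct (fun w => Y i w ^+ 2) by exact: boundedX.
pose T w := g (S w) + Y i w * g1 (S w) + 2^-1 * (Y i w ^+ 2 * g2 (S w)).
have bT : bounded_fct T.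
  apply: boundedD; last by apply: boundedM; [exact: bounded_cst|apply: boundedM => //; exact: bS].
  by apply: boundedD; [exact: bS|apply: boundedM => //; exact: bS].
have LT : L T = L (fun w => g (S w)) + v i / 2 * L (fun w => g2 (S w)).
  have [Yg1 Yg2] := mean_rest us bg1; have [_ Y2g2] := mean_rest us bg2.
  rewrite (meanD mL); last 2 first.
  - by apply: boundedD; [exact: bS|apply: boundedM => //; exact: bS].
  - by apply: boundedM; [exact: bounded_cst|apply: boundedM => //; exact: bS].
  rewrite (meanD mL); last 2 first.
  - exact: bS.
  - by apply: boundedM => //; exact: bS.
  rewrite (meanZ mL); last by apply: boundedM => //; exact: bS.
  by rewrite Yg1 Y2g2 addr0 mulrA (mulrC 2^-1).
have LY2 : L (fun w => Y i w ^+ 2) = v i.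
  have [_] := mean_rest us (bounded_cst 1).
  by rewrite (mean_cst mL) mulr1; under eq_fun do rewrite mulr1.
have cons_step : `|L (fun w => g (\sum_(j <- i :: s) Y j w)) - L T| <= M * v i.
  rewrite -LY2 -(meanZ mL)//; apply: (mean_dist mL) => //.
  - by case: bg => C gC; exists C.
  - by apply: boundedM => //; exact: bounded_cst.
  - move=> w; rewrite big_cons -/(S w) (addrC (Y i w)) /T.
    rewrite (_ : _ - _ = g (S w + Y i w) - g (S w) - Y i w * g1 (S w) -
      Y i w ^+ 2 / 2 * g2 (S w)); last by field.
    apply: le_trans (tg _ _) _; rewrite ler_wpM2l//.
    by rewrite -(real_normK (num_real (Y i w))) ler_wiXn2l.
have tail_step : `|L T - L (fun w => gauss_smooth h (v i + u) (S w))|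
    <= M * gauss_abs3 * v i.
  rewrite LT -(mean_cst mL (M * gauss_abs3 * v i)).
  rewrite -(meanZ mL); last exact: bS.
  rewrite -(meanD mL); last 2 first.
  - exact: bS.
  - by apply: boundedM; [exact: bounded_cst|exact: bS].
  apply: (mean_dist mL).
  - apply: boundedD; first exact: bS.
    by apply: boundedM; [exact: bounded_cst|exact: bS].
  - exists 1 => w; rewrite ger0_norm; first exact: gauss_smooth_le1.
    exact: gauss_smooth_ge0.
  - exact: bounded_cst.
  - move=> w; rewrite -(gauss_smooth_semigroup ch h01)// -/g distrC opprD addrA.
    have gB x : `|g x| <= 1 by have /andP[? ?] := g01 x; rewrite ger0_norm.
    have mg : measurable_fun [set: R] g.
      exact: continuous_measurable_fun (cubic_taylor_continuous tg).
    apply: le_trans (gauss_smooth_taylor _ v0 mg gB tg) _.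
    rewrite ler_wpM2l ?mulr_ge0 ?gauss_abs3_ge0//.
    have q0 := sqrtr_ge0 (v i); rewrite -[leRHS](sqr_sqrtr v0).
    by rewrite ler_wiXn2l// -sqrtr1 ler_wsqrtr.
apply: le_trans (ler_distD (L T) _ _) _.
by rewrite mulrDr mulr1 mulrDl lerD.
Qed.

(** Replace the summands one at a time by independent normal variables of the
    same variance; the normal variables accumulated so far sit in the heat
    semigroup. Both replacements have the same expansion to order two. *)
Lemma lindeberg (s : seq I) : uniq s ->
  `|L (fun w => h (\sum_(i <- s) Y i w)) - gauss_smooth h (\sum_(i <- s) v i) 0|
    <= M * (1 + gauss_abs3) * \sum_(i <- s) v i.
Proof.
suff H u : 0 <= u -> uniq s ->
  `|L (fun w => gauss_smooth h u (\sum_(i <- s) Y i w)) -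
    gauss_smooth h (\sum_(i <- s) v i + u) 0|
    <= M * (1 + gauss_abs3) * \sum_(i <- s) v i.
  move=> us; have := H 0 (lexx 0) us; rewrite addr0.
  by under eq_fun do rewrite gauss_smooth0//.
elim: s u => [|i s IHs] u u0 us.
  under eq_fun do rewrite big_nil.
  by rewrite mean_cst// !big_nil add0r subrr normr0 mulr0.
have /andP[vi0 _] := v01 i; have /andP[_ us'] := us.
apply: le_trans (ler_distD (L (fun w => gauss_smooth h (v i + u) (\sum_(j <- s) Y j w))) _ _) _.
rewrite [X in _ <= _ * X]big_cons mulrDr lerD//; first exact: lindeberg_step.
rewrite (_ : \sum_(j <- i :: s) v j + u = \sum_(j <- s) v j + (v i + u)).
  by apply: IHs => //; rewrite addr_ge0.
by rewrite big_cons; ring.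
Qed.

End lindeberg.

(** * Integration over a sample of Poissonian size *)

Section iterated_integral.
Context {R : realType} {S : countType} (mu : probability {fset S} R).
Local Open Scope ereal_scope.
Implicit Types (f : seq {fset S} -> \bar R) (A : {fset S}) (xs ys : seq {fset S}).

Lemma measurable_fset_fun d (T : measurableType d) (D : set {fset S})
  (f : {fset S} -> T) : measurable_fun D f.
Proof. by []. Qed.
Hint Resolve measurable_fset_fun : core.

(** The integral of [f] against the law of [k] independent observations. *)
Fixpoint iid_integral k f : \bar R :=
  if k is k'.+1 then \int[mu]_A iid_integral k' (fun xs => f (A :: xs))
  else f [::].

Lemma iid_integral_ge0 k f : (forall xs, 0 <= f xs) -> 0 <= iid_integral k f.
Proof.
elim: k f => [|k IHk] f f0 //=.
by apply: integral_ge0 => A _; apply: IHk.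
Qed.

Lemma iid_integralZl k f c : (0 <= c) -> (forall xs, 0 <= f xs) ->
  iid_integral k (fun xs => c * f xs) = c * iid_integral k f.
Proof.
move=> c0; elim: k f => [|k IHk] f f0 //=.
under eq_integral do rewrite IHk//.
by rewrite ge0_integralZl// => A _; exact: iid_integral_ge0.
Qed.

Lemma iid_integral_cst0 k : iid_integral k (fun=> 0) = 0.
Proof.
elim: k => [|k IHk] //=; under eq_integral do rewrite IHk.
exact: integral0.
Qed.

Lemma iid_integral_cat k l (f : seq {fset S} -> seq {fset S} -> \bar R) :
  iid_integral (k + l) (fun zs => f (take k zs) (drop k zs)) =
  iid_integral k (fun xs => iid_integral l (f xs)).
Proof.
elim: k f => [|k IHk] f /=.
  by congr (iid_integral _ _); apply/funext => zs; rewrite take0 drop0.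
by apply: eq_integral => A _; rewrite -IHk.
Qed.

Lemma iid_integral_nneseries k (f : nat -> seq {fset S} -> \bar R) :
  (forall l xs, 0 <= f l xs) ->
  iid_integral k (fun xs => \sum_(0 <= l <oo) f l xs) =
  \sum_(0 <= l <oo) iid_integral k (f l).
Proof.
elim: k f => [|k IHk] f f0 //=.
under eq_integral do rewrite IHk//.
by rewrite integral_nneseries// => l A _; exact: iid_integral_ge0.
Qed.

Variable s : S.
(** The observations that do not contain [s]: what is known of a sample when the
    abundance of [s] is ignored. *)
Definition erase xs := [seq A <- xs | s \notin (A : {fset S})].
Let D : set {fset S} := [set A | s \in (A : {fset S})].
Let p := mu D.

Let q k a (phi : seq {fset S} -> \bar R) := iid_integral k
  (fun xs => if abundance xs s == a then phi (erase xs) else 0).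

Let q_ge0 k a phi : (forall xs, 0 <= phi xs) -> 0 <= q k a phi.
Proof. by move=> phi0; apply: iid_integral_ge0 => xs; case: ifP. Qed.

(* Condition on whether the first observation contains [s]. *)
Let q_split k a phi : (forall xs, 0 <= phi xs) -> q k.+1 a phi =
  p * (if a is a'.+1 then q k a' phi else 0) +
  \int[mu]_(A in ~` D) q k a (fun xs => phi (A :: xs)).
Proof.
move=> phi0; rewrite {1}/q /= -(setUv D) ge0_integral_setU//; last 2 first.
- by move=> A _; apply: iid_integral_ge0 => xs; case: ifP.
- by rewrite disj_set2E setICr.
congr (_ + _).
  rewrite muleC -integral_cst//; apply: eq_integral => A /set_mem/= DA.
  have sA : s \in A by exact: DA.
  case: a => [|a].
    transitivity (iid_integral k (fun=> 0)); last exact: iid_integral_cst0.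
    by congr (iid_integral _ _); apply/funext => xs; rewrite sA.
  congr (iid_integral _ _); apply/funext => xs.
  by rewrite sA add1n eqSS.
apply: eq_integral => A /set_mem/= DA.
have sA : s \notin A by apply/negP; exact: DA.
congr (iid_integral _ _); apply/funext => xs.
by rewrite (negbTE sA).
Qed.

(** Removing one of the [a.+1] observations of [s] from a sample of size
    [k.+1]: a size-biasing identity, obtained here by induction on the sample
    instead of by exchangeability. *)
Let q_mecke k a phi : (forall xs, 0 <= phi xs) ->
  a.+1%:R%:E * q k.+1 a.+1 phi = k.+1%:R%:E * (p * q k a phi).
Proof.
elim: k a phi => [|k IHk] a phi phi0.
  rewrite q_split// [X in _ + X]integral0_eq ?adde0//.
  by rewrite /q/=; case: eqVneq => [<-//|_]; rewrite !mule0.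
have p0 : 0 <= p := measure_ge0 mu D.
have I0 j b : 0 <= \int[mu]_(A in ~` D) q j b (fun xs => phi (A :: xs)).
  by apply: integral_ge0 => A _; exact: q_ge0.
have IH : a.+1%:R%:E * \int[mu]_(A in ~` D) q k.+1 a.+1 (fun xs => phi (A :: xs)) =
    k.+1%:R%:E * (p * \int[mu]_(A in ~` D) q k a (fun xs => phi (A :: xs))).
  rewrite -!ge0_integralZl//; try by move=> A _; rewrite ?mule_ge0 ?q_ge0.
  by apply: eq_integral => A _; rewrite IHk.
rewrite q_split// ge0_muleDr ?mule_ge0 ?q_ge0// IH.
rewrite -[in RHS]natr1 EFinD ge0_muleDl ?mul1e//.
rewrite [X in X + _ = _](_ : _ = p * q k.+1 a phi + p * (a%:R%:E * q k.+1 a phi)); last first.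
  by rewrite -natr1 EFinD ge0_muleDl ?lee_fin// mul1e addeC muleCA.
rewrite -addeA [RHS]addeC; congr (_ + _).
rewrite [X in _ + X]muleCA [RHS]muleCA -ge0_muleDr ?mule_ge0 ?q_ge0 ?lee_fin//.
congr (p * _).
case: a {IH} => [|a]; first by rewrite mul0e add0e q_split// mule0 add0e.
by rewrite IHk// [in RHS]q_split// [RHS]ge0_muleDr ?mule_ge0 ?q_ge0.
Qed.

(** The integral of [f] against the law of a sample of Poissonian size. *)
Definition poisson_integral (t : R) f : \bar R :=
  \sum_(0 <= k <oo) (poisson_pmf t k)%:E * iid_integral k f.

Lemma poisson_integral_ge0 t f : (forall xs, 0 <= f xs) -> 0 <= poisson_integral t f.
Proof.
move=> f0; apply: nneseries_ge0 => k _ _.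
by rewrite mule_ge0 ?lee_fin ?poisson_pmf_ge0// iid_integral_ge0.
Qed.

Lemma poisson_integralZl t f (c : R) : (0 <= c)%R -> (forall xs, 0 <= f xs) ->
  poisson_integral t (fun xs => c%:E * f xs) = c%:E * poisson_integral t f.
Proof.
move=> c0 f0; rewrite /poisson_integral -nneseriesZl; last first.
  by move=> k _; rewrite mule_ge0 ?lee_fin ?poisson_pmf_ge0// iid_integral_ge0.
by apply: eq_eseriesr => k _; rewrite iid_integralZl ?lee_fin// muleCA.
Qed.

(** Given the rest of the sample, the abundance of [s] satisfies the Mecke
    recursion of the Poisson law of parameter [t * mu D]. *)
Lemma poisson_integral_abundance (t : R) a phi : (0 < t)%R -> (forall xs, 0 <= phi xs) ->
  poisson_integral t (fun xs => if abundance xs s == a then phi (erase xs) else 0) =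
  ((t * fine (mu [set A | s \in (A : {fset S})])) ^+ a / a`!%:R)%:E *
  poisson_integral t (fun xs => if abundance xs s == 0%N then phi (erase xs) else 0).
Proof.
move=> t0 phi0; rewrite -/D.
elim: a => [|a IHa]; first by rewrite expr0 fact0 divr1 mul1e.
set X := LHS; pose Y := poisson_integral t
  (fun xs => if abundance xs s == a then phi (erase xs) else 0).
suff H : a.+1%:R%:E * X = (t * fine p)%:E * Y.
  have -> : X = (a.+1%:R^-1)%:E * (a.+1%:R%:E * X).
    by rewrite muleA -EFinM mulVf ?mul1e// pnatr_eq0.
  rewrite H /Y IHa !muleA -!EFinM; congr (_%:E * _).
  rewrite exprS factS natrM; field.
  by rewrite addrC natr1 !pnatr_eq0 -lt0n fact_gt0.
rewrite /X /Y /poisson_integral -!nneseriesZl; last 2 first.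
- by move=> k _; rewrite mule_ge0 ?lee_fin ?poisson_pmf_ge0// q_ge0.
- by move=> k _; rewrite mule_ge0 ?lee_fin ?poisson_pmf_ge0// q_ge0.
rewrite nneseries_recl//; last first.
  by move=> k _; rewrite !mule_ge0 ?lee_fin ?poisson_pmf_ge0// q_ge0.
rewrite [X in _ * (_ * X)](_ : _ = 0)//= !mule0 add0e -nneseries_addn; last first.
  by move=> k; rewrite !mule_ge0 ?lee_fin ?poisson_pmf_ge0// q_ge0.
apply: eq_eseriesr => k _; rewrite addn1 muleCA q_mecke// !muleA.
have pE : p = (fine p)%:E by rewrite fineK ?fin_num_measure.
rewrite [in LHS]pE -!EFinM; congr (_%:E * _).
rewrite /poisson_pmf t0 exprS factS natrM; field.
by rewrite addrC natr1 !pnatr_eq0 -lt0n fact_gt0.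
Qed.

End iterated_integral.

(** * The law of the two samples *)

Section countable_valued.
Local Open Scope ereal_scope.

Lemma measurable_countable_fun d d' (T : measurableType d) (U : measurableType d')
    (C : countType) (Z : T -> C) (g : C -> U) :
  (forall z, measurable (Z @^-1` [set z])) -> measurable_fun [set: T] (g \o Z).
Proof.
move=> mZ _ B mB; rewrite setTI.
pose F z := if `[< B (g z) >] then Z @^-1` [set z] else set0.
rewrite (_ : _ @^-1` B = \bigcup_z F z); last first.
  apply/seteqP; split=> [w /= Bw|w [z _]]; last first.
    by rewrite /F; case: asboolP => // Bz; rewrite /preimage/= => ->.
  by exists (Z w) => //; rewrite /F; case: asboolP.
apply: countable_bigcupT_measurable => [|z]; first exact: countableP.
by rewrite /F; case: ifP => _ //.
Qed.

Lemma ge0_integral_fibers d (T : measurableType d) (R : realType)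
    (P : {measure set T -> \bar R}) (D : set T) (Z : T -> nat) (f : T -> \bar R) :
  measurable D -> (forall i, measurable (Z @^-1` [set i])) ->
  measurable_fun D f -> (forall w, 0 <= f w) ->
  \int[P]_(w in D) f w = \sum_(0 <= i <oo) \int[P]_(w in D `&` Z @^-1` [set i]) f w.
Proof.
move=> mD mZ mf f0.
have DE : \bigcup_i (D `&` Z @^-1` [set i]) = D.
  apply/seteqP; split=> [w [i _ []]//|w Dw]; by exists (Z w).
rewrite -{1}DE ge0_integral_bigcup//.
- by move=> i; exact: measurableI.
- by rewrite DE.
- apply/trivIsetP => i j _ _ ij; apply/seteqP; split=> w //= [[_ iE] [_ jE]].
  by move: ij; rewrite -iE -jE eqxx.
Qed.

End countable_valued.

Section disintegration.
Context d (Omega : measurableType d) (R : realType) (P : probability Omega R).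
Context (S : countType) (X : nat -> {RV P >-> {fset S}}) (n m : {RV P >-> nat}).
Context (mu : probability {fset S} R) (t t' : R).
Hypotheses (t0 : 0 < t) (t'0 : 0 < t').
Hypothesis sampling : poissonized_sampling X n m mu t t'.
Local Open Scope ereal_scope.

Let sample j i w : seq {fset S} := [seq X k w | k <- iota j i].

Let cylinder k l (As : seq {fset S}) : set Omega :=
  (n @^-1` [set k] `&` m @^-1` [set l]) `&` (sample 0 (size As)) @^-1` [set As].

Let measurable_X i A : measurable (X i @^-1` [set A]).
Proof. by rewrite -[X in measurable X]setTI; exact: measurable_funPT. Qed.

Let measurable_sample j i zs : measurable (sample j i @^-1` [set zs]).
Proof.
elim: i j zs => [|i IHi] j [|A zs].
- by rewrite (_ : _ @^-1` _ = setT)//; apply/seteqP; split.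
- by rewrite (_ : _ @^-1` _ = set0)//; apply/seteqP; split.
- by rewrite (_ : _ @^-1` _ = set0)//; apply/seteqP; split.
- rewrite (_ : _ @^-1` _ = (X j @^-1` [set A]) `&` (sample j.+1 i @^-1` [set zs])).
    exact: measurableI.
  by apply/seteqP; split=> w; rewrite /preimage /sample/= => -[-> ->].
Qed.

Let measurable_sizes k l : measurable (n @^-1` [set k] `&` m @^-1` [set l]).
Proof. by apply: measurableI; rewrite -[X in measurable X]setTI; exact: measurable_funPT. Qed.

Let measurable_cylinder k l As : measurable (cylinder k l As).
Proof. by apply: measurableI. Qed.

(* The members of the independent family that determine a cylinder with [N]
   prescribed observations. *)
Let index_set N : {fset (nat + bool)} :=
  iteri N (fun i J => inl i |` J)%fset [fset inr true; inr false]%fset.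

Let mem_index_set N i : (inl i \in index_set N) = (i < N)%N.
Proof.
elim: N => [|N IHN]; first by rewrite /index_set/= !inE.
by rewrite /index_set/= in_fset1U -/(index_set N) IHN [in RHS]ltnS [in RHS]leq_eqVlt.
Qed.

Let mem_index_set_inr N b : inr b \in index_set N.
Proof.
elim: N => [|N IHN]; first by rewrite /index_set/= !inE; case: b.
by rewrite /index_set/= in_fset1U -/(index_set N) IHN orbT.
Qed.

Let prob_cylinder k l As : P (cylinder k l As) =
  (poisson_pmf t k)%:E * (poisson_pmf t' l)%:E * \prod_(A <- As) mu [set A].
Proof.
pose E (i : nat + bool) : set Omega := match i with
  | inl i => X i @^-1` [set nth fset0 As i]
  | inr true => n @^-1` [set k]
  | inr false => m @^-1` [set l] end.
have := sampling_independence sampling (J := index_set (size As)) (A := E).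
rewrite (_ : \bigcap_(i in _) _ = cylinder k l As); last first.
  apply/seteqP; split => w.
    move=> H; split; first by split; [exact: (H (inr true) (mem_index_set_inr _ _))|
      exact: (H (inr false) (mem_index_set_inr _ _))].
    apply: (@eq_from_nth _ fset0) => [|i]; rewrite size_map size_iota// => iA.
    rewrite (nth_map 0%N) ?size_iota// nth_iota//.
    by apply: (H (inl i)); rewrite /= mem_index_set.
  move=> [[nk ml] sA] [i|[]] //=; rewrite mem_index_set => iA.
  have -> : nth fset0 As i = nth fset0 (sample 0 (size As) w) i by rewrite sA.
  by rewrite (nth_map 0%N) ?size_iota// nth_iota.
move=> ->; last first.
  by move=> [i|[]] _ /=; (eexists; last by rewrite setTI; reflexivity).
have -> : forall N, \prod_(i <- index_set N) P (E i) =
    (poisson_pmf t k)%:E * (poisson_pmf t' l)%:E *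
    \prod_(0 <= i < N) mu [set nth fset0 As i].
  elim=> [|N IHN].
    rewrite /index_set/= big_fsetU1 ?inE// big_seq_fset1 big_nil mule1 /=.
    have poissonE (u : R) j : (0 < u)%R -> poisson_prob u 0%N [set j] = (poisson_pmf u j)%:E.
      by move=> u0; rewrite /poisson_prob u0 esum_set1// lee_fin poisson_pmf_ge0.
    congr (_ * _).
      by have /(congr1 (fun q => q [set k])) := law_first_size sampling; rewrite poissonE.
    by have /(congr1 (fun q => q [set l])) := law_second_size sampling; rewrite poissonE.
  rewrite /index_set/= big_fsetU1; last by rewrite mem_index_set ltnn.
  rewrite -/(index_set N) IHN big_nat_recr//= [LHS]muleC [RHS]muleA; congr (_ * _).
  have /(congr1 (fun q => q [set nth fset0 As N])) := law_sample sampling N.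
  exact.
by rewrite (big_nth fset0).
Qed.

Let measurable_fun_sample (g : seq {fset S} -> R) j i (D : set Omega) :
  measurable_fun D (fun w => (g (sample j i w))%:E).
Proof.
apply: measurable_funTS; apply/measurable_EFinP.
exact: (measurable_countable_fun g (measurable_sample j i)).
Qed.

(* Induction on the number [i] of observations still to be integrated; a step
   moves one of them into the cylinder by conditioning on its value. *)
Let integral_cylinder k l As i (g : seq {fset S} -> R) : (forall zs, 0 <= g zs)%R ->
  \int[P]_(w in cylinder k l As) (g (sample (size As) i w))%:E =
  P (cylinder k l As) * iid_integral mu i (EFin \o g).
Proof.
elim: i As g => [|i IHi] As g g0.
  by rewrite muleC -integral_cst.
pose code : {fset S} -> nat := @choice.pickle {fset S}.
have mcode j : measurable ((code \o X (size As)) @^-1` [set j]).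
  rewrite -[X in measurable X]setTI.
  exact: (measurable_countable_fun code (measurable_X (size As))).
rewrite (@ge0_integral_fibers _ _ _ _ _ (code \o X (size As)))//; last first.
  by move=> w; rewrite lee_fin.
have I0 A : 0 <= iid_integral mu i (fun xs => (g (A :: xs))%:E).
  by apply: iid_integral_ge0 => xs; rewrite lee_fin.
rewrite /= (@ge0_integral_fibers _ _ _ mu setT code)//.
rewrite -[P _]fineK ?fin_num_measure// -nneseriesZl; last first.
  by move=> j _; exact: integral_ge0.
apply: eq_eseriesr => j _; rewrite fineK ?fin_num_measure// setTI.
have codeE : code @^-1` [set j] = if @pickle_inv {fset S} j is Some A then [set A] else set0.
  have := @pickle_invK {fset S} j; case jE: pickle_inv => [A|] /= jA.
    apply/seteqP; split=> B /=; last by move=> ->.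
    by rewrite -jA => /(pcan_inj (@pickleK_inv _)).
  apply/seteqP; split=> B //= Bj.
  by move: jE; rewrite -Bj pickleK_inv.
rewrite comp_preimage codeE; case: pickle_inv {codeE} => [A|]; last first.
  by rewrite preimage_set0 setI0 !integral_set0 mule0.
rewrite [X in _ * X](_ : _ =
    iid_integral mu i (fun xs => (g (A :: xs))%:E) * mu [set A]); last first.
  by rewrite -integral_cst//; apply: eq_integral => B /set_mem ->.
have sampleS w : sample 0 (size As).+1 w = rcons (sample 0 (size As) w) (X (size As) w).
  by rewrite /sample -[(size As).+1]addn1 iotaD map_cat cats1.
rewrite (_ : _ `&` _ = cylinder k l (rcons As A)); last first.
  rewrite /cylinder size_rcons.
  apply/seteqP; split=> w; rewrite /preimage/= sampleS.
    by move=> [[? sA] XA]; split; rewrite ?sA ?XA.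
  by move=> [? /rcons_inj[? ?]].
transitivity (\int[P]_(w in cylinder k l (rcons As A))
    (g (A :: sample (size (rcons As A)) i w))%:E).
  apply: eq_integral => w /set_mem[_]; rewrite /preimage/= size_rcons sampleS.
  by move=> /rcons_inj[_ XA]; rewrite /sample/= XA.
rewrite (IHi _ (fun zs => g (A :: zs)))// !prob_cylinder -cats1 big_cat big_seq1.
by rewrite muleA -!muleA; congr (_ * (_ * (_ * _))); rewrite muleC.
Qed.

(** Split according to the two sizes, then integrate the observations one after
    the other. Everything that depends on the joint law of the observations and
    of the sizes goes through this formula. *)
Lemma integral_samples (f : seq {fset S} -> seq {fset S} -> R) :
  (forall xs ys, 0 <= f xs ys)%R ->
  \int[P]_w (f (first_sample X n w) (second_sample X n m w))%:E =
  poisson_integral mu t (fun xs => poisson_integral mu t' (fun ys => (f xs ys)%:E)).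
Proof.
move=> f0.
have mf D : measurable_fun D
    (fun w => (f (first_sample X n w) (second_sample X n m w))%:E).
  by apply: measurable_funTS; apply/measurable_EFinP; exact: measurable_sample_statistic.
have mn (N : {RV P >-> nat}) i : measurable (N @^-1` [set i]).
  by rewrite -[X in measurable X]setTI; exact: measurable_funPT.
rewrite (@ge0_integral_fibers _ _ _ P setT n)//; last by move=> w; rewrite lee_fin.
rewrite /poisson_integral; apply: eq_eseriesr => k _; rewrite setTI.
have I0 l xs : 0 <= (poisson_pmf t' l)%:E * iid_integral mu l (fun ys => (f xs ys)%:E).
  by rewrite mule_ge0 ?lee_fin ?poisson_pmf_ge0// iid_integral_ge0// => ys; rewrite lee_fin.
rewrite iid_integral_nneseries// -nneseriesZl; last first.
  by move=> l _; exact: iid_integral_ge0.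
rewrite (@ge0_integral_fibers _ _ _ P _ m)//; last by move=> w; rewrite lee_fin.
apply: eq_eseriesr => l _.
rewrite iid_integralZl ?lee_fin ?poisson_pmf_ge0//; last first.
  by move=> xs; apply: iid_integral_ge0 => ys; rewrite lee_fin.
rewrite -(iid_integral_cat _ _ _ (fun xs ys => (f xs ys)%:E)) muleA.
transitivity (\int[P]_(w in cylinder k l [::])
    (f (take k (sample 0 (k + l) w)) (drop k (sample 0 (k + l) w)))%:E).
  rewrite (_ : cylinder k l [::] = n @^-1` [set k] `&` m @^-1` [set l]); last first.
    by apply/seteqP; split=> w; [case|split].
  apply: eq_integral => w /set_mem[/= nk ml]; rewrite /first_sample /second_sample nk ml.
  by rewrite /sample iotaD map_cat take_size_cat ?drop_size_cat ?size_map ?size_iota.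
rewrite (integral_cylinder k l [::] (k + l) (g := fun zs => f (take k zs) (drop k zs)))//.
by rewrite prob_cylinder big_nil mule1.
Qed.

End disintegration.

(** * Generating functions of the abundances *)

Section sample_mean.
Context d (Omega : measurableType d) (R : realType) (P : probability Omega R).
Context (S : countType) (X : nat -> {RV P >-> {fset S}}) (n m : {RV P >-> nat}).
Let W := (seq {fset S} * seq {fset S})%type.
Implicit Types (f g : W -> R).

Definition sample_mean f : R :=
  \int[P]_w f (first_sample X n w, second_sample X n m w).

Let measurable_sample f (D : set Omega) :
  measurable_fun D (fun w => f (first_sample X n w, second_sample X n m w)).
Proof.
by apply: measurable_funTS; exact: (measurable_sample_statistic X n m (fun xs ys => f (xs, ys))).
Qed.

Lemma integrable_sample f : bounded_fct f -> P.-integrable [set: Omega]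
  (EFin \o (fun w => f (first_sample X n w, second_sample X n m w))).
Proof.
move=> [C fC]; apply: (@le_integrable _ _ _ P setT _ _ (cst C%:E)) => //=.
- exact/measurable_EFinP.
- by move=> w _; rewrite lee_fin (le_trans (fC _))// ler_norm.
- exact: finite_measure_integrable_cst.
Qed.

Lemma sample_mean_functional : mean_functional sample_mean.
Proof.
split => [a f g bf bg|f g bf bg fg|].
- rewrite /sample_mean RintegralD//; last 2 first.
  + by apply: (integrableZl _ a (integrable_sample bf)).
  + exact: integrable_sample.
  by rewrite RintegralZl//; exact: integrable_sample.
- by apply: le_Rintegral => //; exact: integrable_sample.
- rewrite /sample_mean Rintegral_cst// mul1r.
  by apply: (congr1 fine (y := 1%E)); exact: probability_setT.
Qed.

Lemma sample_mean_indic (B : set W) :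
  (P [set w | B (first_sample X n w, second_sample X n m w)] =
   (sample_mean (\1_B))%:E)%E.
Proof.
pose F w : W := (first_sample X n w, second_sample X n m w).
have mB : measurable (F @^-1` B).
  rewrite (_ : _ @^-1` B = (fun w => \1_B (F w) : R) @^-1` [set 1]); last first.
    apply/seteqP; split=> w; rewrite /preimage/= indicE; first by move=> /mem_set ->.
    case: (boolP (F w \in B)) => [/set_mem//|_ /eqP].
    by rewrite eq_sym oner_eq0.
  rewrite -[X in measurable X]setTI.
  by apply: (measurable_sample (\1_B)) => //; exact: measurable_set1.
rewrite -[LHS](_ : \int[P]_w (\1_(F @^-1` B) w)%:E = _)%E; last first.
  by rewrite integral_indic// setIT.
rewrite /sample_mean fineK//.
apply: integrable_fin_num => //; apply: integrable_sample.
by exists 1 => w; rewrite indicE; case: (_ \in _); rewrite ?normr1 ?normr0.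
Qed.

Lemma sample_mean_near (f_ : nat -> W -> R) f C :
  (forall k w, `|f_ k w| <= C) -> (forall w, \forall k \near \oo, f_ k w = f w) ->
  sample_mean (f_ k) @[k --> \oo] --> sample_mean f.
Proof.
move=> f_C f_f.
have bf : bounded_fct f.
  exists C => w; have [k _ /(_ k (leqnn k)) <-] := f_f w; exact: f_C.
apply: fine_cvg; rewrite fineK; last exact: integrable_fin_num (integrable_sample bf).
apply: (@dominated_cvg _ _ _ P setT measurableT _ _ (cst C%:E)) => //=.
- by move=> N; apply/measurable_EFinP; exact: measurable_sample.
- move=> w _; apply: (@cvg_near_cst _ _ _ _ \oo).
  near=> k; congr (_%:E); near: k; exact: f_f.
- exact: finite_measure_integrable_cst.
- by move=> N w _; rewrite lee_fin.
Unshelve. all: by end_near. Qed.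

(** If [c] has Poisson weights of parameter [lam] next to [f], up to
    normalization, then summing them against [z ^+ c] gives
    [expR (lam * z)] times the weight of [c = 0]; the case [z = 1] identifies the
    latter. *)
Lemma sample_mean_power (c : W -> nat) (lam z : R) f : bounded_fct f ->
  (forall a, sample_mean (fun w => (c w == a)%:R * f w) =
     lam ^+ a / a`!%:R * sample_mean (fun w => (c w == 0)%:R * f w)) ->
  `|z| <= 1 ->
  sample_mean (fun w => z ^+ c w * f w) = expR (- (lam * (1 - z))) * sample_mean f.
Proof.
move=> bf fa; set e0 := sample_mean (fun w => (c w == 0)%:R * f w) in fa *.
suff H y : `|y| <= 1 -> sample_mean (fun w => y ^+ c w * f w) = expR (y * lam) * e0.
  move=> z1; rewrite H// -[in RHS](_ : (fun w => 1 ^+ c w * f w) = f); last first.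
    by apply/funext => w; rewrite expr1n mul1r.
  by rewrite H ?normr1// mulrA -expRD; congr (expR _ * _); ring.
move=> y1; have [C fC] := bf.
have b1 a : bounded_fct (fun w => (c w == a)%:R * f w).
  apply: boundedM => //; exists 1 => w.
  by case: eqP; rewrite ?normr1 ?normr0.
pose u N w := \sum_(a < N) y ^+ a * ((c w == a)%:R * f w).
have uE N w : u N w = if (c w < N)%N then y ^+ c w * f w else 0.
  rewrite /u; case: ltnP => cN.
    rewrite (bigD1 (Ordinal cN))//= eqxx mul1r big1 ?addr0// => a.
    rewrite -val_eqE eq_sym/= => /negbTE ->.
    by rewrite mul0r mulr0.
  rewrite big1// => a _; rewrite (_ : (_ == _) = false) ?mul0r ?mulr0//.
  by apply/negbTE; rewrite neq_ltn (leq_trans (ltn_ord a) cN) orbT.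
have lim1 : sample_mean (u N) @[N --> \oo] --> expR (y * lam) * e0.
  have -> : (fun N => sample_mean (u N)) = (fun N => series (exp_coeff (y * lam)) N * e0).
    apply/funext => N; rewrite /series/= mulr_suml big_mkord /u.
    elim: N => [|N IHN].
      by rewrite big_ord0 (_ : (fun w => _) = fun=> 0) ?(mean_cst sample_mean_functional)//;
        apply/funext => w; rewrite big_ord0.
    rewrite big_ord_recr/= -IHN.
    rewrite (_ : (fun w => _) = (fun w => \sum_(a < N) y ^+ a * ((c w == a)%:R * f w)
      + y ^+ N * ((c w == N)%:R * f w))); last by apply/funext => w; rewrite big_ord_recr.
    rewrite (meanD sample_mean_functional)//; last 2 first.
    + have -> : (fun w => \sum_(a < N) y ^+ a * ((c w == a)%:R * f w)) = u N by [].
      exists C => w; rewrite uE; case: ifP => _; last first.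
        by rewrite normr0 (le_trans _ (fC w)).
      rewrite normrM normrX (le_trans _ (fC w))// ler_piMl//.
      by rewrite exprn_ile1.
    + by apply: boundedM => //; exact: bounded_cst.
    rewrite (meanZ sample_mean_functional)// fa /exp_coeff/= exprMn; congr (_ + _).
    by ring.
  apply: cvgMl; rewrite /expR; exact: is_cvg_series_exp_coeff.
have buC N w : `|u N w| <= C.
  rewrite uE; case: ifP => _; last by rewrite normr0 (le_trans _ (fC w)).
  rewrite normrM normrX (le_trans _ (fC w))// ler_piMl//.
  by rewrite exprn_ile1.
have lim2 : sample_mean (u N) @[N --> \oo] --> sample_mean (fun w => y ^+ c w * f w).
  apply: (sample_mean_near buC) => w; near=> N.
  by rewrite uE ifT//; near: N; exact: nbhs_infty_gt.
exact: cvg_unique lim2 lim1.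
Unshelve. all: by end_near. Qed.

End sample_mean.

Section generating_function.
Context d (Omega : measurableType d) (R : realType) (P : probability Omega R).
Context (S : countType) (X : nat -> {RV P >-> {fset S}}) (n m : {RV P >-> nat}).
Context (mu : probability {fset S} R) (t t' : R).
Hypotheses (t0 : 0 < t) (t'0 : 0 < t').
Hypothesis sampling : poissonized_sampling X n m mu t t'.
Let W := (seq {fset S} * seq {fset S})%type.
Let L := sample_mean X n m.
Let mL : mean_functional L := sample_mean_functional X n m.
Implicit Types (f psi : W -> R) (s : S).

Let sample_meanE f : bounded_fct f -> (forall w, 0 <= f w) -> (L f)%:E =
  poisson_integral mu t (fun xs => poisson_integral mu t' (fun ys => (f (xs, ys))%:E)).
Proof.
move=> bf f0; rewrite -(integral_samples t0 t'0 sampling (f := fun xs ys => f (xs, ys)))//.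
by rewrite /L /sample_mean fineK//; exact: integrable_fin_num (integrable_sample _ _ _ bf).
Qed.

Let bounded_indic (c : W -> nat) a psi (e : W -> W) : bounded_fct psi ->
  bounded_fct (fun w => (c w == a)%:R * psi (e w)).
Proof.
move=> [C psiC]; apply: boundedM; last by exists C.
by exists 1 => w; case: eqP; rewrite ?normr1 ?normr0.
Qed.

(* The weights are known for nonnegative functions only, since they come from
   integrals of nonnegative functions; adding a constant removes the sign. *)
Let sample_mean_power_erase (c : W -> nat) (e : W -> W) (lam z : R) psi :
  (forall a psi, bounded_fct psi -> (forall w, 0 <= psi w) ->
    L (fun w => (c w == a)%:R * psi (e w)) =
    lam ^+ a / a`!%:R * L (fun w => (c w == 0)%:R * psi (e w))) ->
  bounded_fct psi -> `|z| <= 1 ->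
  L (fun w => z ^+ c w * psi (e w)) = expR (- (lam * (1 - z))) * L (fun w => psi (e w)).
Proof.
move=> H bpsi z1; have [C psiC] := bpsi.
apply: sample_mean_power => // [|a]; first by exists C.
have C0 : 0 <= C by exact: le_trans (psiC ([::], [::])).
have bC : bounded_fct (fun w => psi w + C) by apply: boundedD => //; exact: bounded_cst.
have split_psi b : L (fun w => (c w == b)%:R * psi (e w)) =
    L (fun w => (c w == b)%:R * (psi (e w) + C)) - L (fun w => (c w == b)%:R * C).
  rewrite -(meanB mL).
  - by congr L; apply/funext => w; ring.
  - exact: (bounded_indic c b e bC).
  - exact: (bounded_indic c b e (bounded_cst C)).
rewrite /= -/L !split_psi mulrBr; congr (_ - _).
  apply: (H a (fun w => psi w + C)) => // w.
  by rewrite -lerBlDr sub0r; have /ler_normlP[] := psiC w; lra.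
by apply: (H a (fun=> C)) => //; exact: bounded_cst.
Qed.

Definition species_prob s : R := fine (mu [set A | s \in (A : {fset S})]).

Lemma sample_mean_first s z psi : bounded_fct psi -> `|z| <= 1 ->
  L (fun w => z ^+ abundance w.1 s * psi (erase s w.1, w.2)) =
  expR (- (t * species_prob s * (1 - z))) * L (fun w => psi (erase s w.1, w.2)).
Proof.
apply: (sample_mean_power_erase (c := fun w => abundance w.1 s)
  (e := fun w => (erase s w.1, w.2))) => a f bf f0.
apply: EFin_inj; rewrite EFinM !sample_meanE//; last 4 first.
- by apply: bounded_indic.
- by move=> w; rewrite mulr_ge0.
- by apply: bounded_indic.
- by move=> w; rewrite mulr_ge0.
have phi0 xs : (0 <= poisson_integral mu t' (fun ys => (f (xs, ys))%:E))%E.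
  by apply: poisson_integral_ge0 => ys; rewrite lee_fin.
have E b : (fun xs => poisson_integral mu t'
      (fun ys => ((abundance xs s == b)%:R * f (erase s xs, ys))%:E)) =
    (fun xs => if abundance xs s == b then
      poisson_integral mu t' (fun ys => (f (erase s xs, ys))%:E) else 0%E).
  apply/funext => xs; case: eqP => _.
    by congr poisson_integral; apply/funext => ys; rewrite mul1r.
  transitivity (poisson_integral mu t' (fun=> 0%E)).
    by congr poisson_integral; apply/funext => ys; rewrite mul0r.
  by rewrite /poisson_integral eseries0// => k _ _; rewrite iid_integral_cst0 mule0.
rewrite /= !E; exact: (poisson_integral_abundance mu s a t0 phi0).
Qed.

Lemma sample_mean_second s z psi : bounded_fct psi -> `|z| <= 1 ->
  L (fun w => z ^+ abundance w.2 s * psi (w.1, erase s w.2)) =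
  expR (- (t' * species_prob s * (1 - z))) * L (fun w => psi (w.1, erase s w.2)).
Proof.
apply: (sample_mean_power_erase (c := fun w => abundance w.2 s)
  (e := fun w => (w.1, erase s w.2))) => a f bf f0.
apply: EFin_inj; rewrite EFinM !sample_meanE//; last 4 first.
- by apply: bounded_indic.
- by move=> w; rewrite mulr_ge0.
- by apply: bounded_indic.
- by move=> w; rewrite mulr_ge0.
have p0 : 0 <= species_prob s by rewrite fine_ge0.
rewrite -poisson_integralZl; last 2 first.
- by rewrite divr_ge0// exprn_ge0// mulr_ge0// ltW.
- by move=> xs; apply: poisson_integral_ge0 => ys; rewrite lee_fin mulr_ge0.
congr poisson_integral; apply/funext => xs /=.
have E b : (fun ys => ((abundance ys s == b)%:R * f (xs, erase s ys))%:E) =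
    (fun ys => if abundance ys s == b then (f (xs, erase s ys))%:E else 0%E).
  by apply/funext => ys; case: eqP => _; rewrite ?mul1r ?mul0r.
rewrite !E; apply: (poisson_integral_abundance mu s a t'0 (phi := fun ys => (f (xs, ys))%:E)).
by move=> ys; rewrite lee_fin.
Qed.

(** The joint generating function of the two abundances of [s], given the
    observations that do not contain [s]. The samples are treated in turn: each
    step allows any bounded function of the other sample. *)
Lemma sample_mean_generating s z z' psi : bounded_fct psi -> `|z| <= 1 -> `|z'| <= 1 ->
  L (fun w => z ^+ abundance w.1 s * z' ^+ abundance w.2 s *
    psi (erase s w.1, erase s w.2)) =
  expR (- (t * species_prob s * (1 - z)) - t' * species_prob s * (1 - z')) *
  L (fun w => psi (erase s w.1, erase s w.2)).
Proof.
move=> bpsi z1 z'1; have [C psiC] := bpsi.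
have bz (c : W -> nat) : bounded_fct (fun w => z ^+ c w).
  by exists 1 => w; rewrite normrX exprn_ile1.
have := sample_mean_first s (psi := fun w => psi (w.1, erase s w.2)) _ z1.
have := sample_mean_second s
  (psi := fun w => z ^+ abundance w.1 s * psi (erase s w.1, w.2)) _ z'1.
move=> /= H2 H1; rewrite addrC expRD -mulrA -H1; last by exists C.
rewrite -H2.
  by congr L; apply/funext => w; rewrite mulrCA mulrA.
apply: boundedM; first exact: bz.
by exists C.
Qed.

End generating_function.

(** * The contribution of one species *)

Section species_statistics.
Context {R : realType} {S : countType}.
Let W := (seq {fset S} * seq {fset S})%type.
Implicit Types (r : R) (s : S) (w : W).

(** As [0 ^+ a] is the indicator of [a = 0], this is [1] when [s] is seen in the
    second sample only, [(- r) ^+ N] when it is seen [N > 0] times in the first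
    one, and [0] otherwise. Both summands are written with powers because their
    means are values of the generating function. *)
Definition error_summand r s w : R :=
  (- r) ^+ abundance w.1 s - 0 ^+ abundance w.1 s * 0 ^+ abundance w.2 s.

Definition variance_summand r s w : R :=
  r ^+ (2 * abundance w.1 s) - (- r) ^+ abundance w.1 s.

Lemma error_summand_sqr r s w : error_summand r s w ^+ 2 =
  r ^+ (2 * abundance w.1 s) - 0 ^+ abundance w.1 s * 0 ^+ abundance w.2 s.
Proof.
rewrite /error_summand; case: (abundance w.1 s) => [|a].
  by case: (abundance w.2 s) => [|b]; rewrite muln0 !expr0 !(expr0n, exprS, mul0r, mulr0); ring.
by rewrite expr0n/= mul0r !subr0 exprAC sqrrN -exprM.
Qed.

Variable r : R.
Hypothesis r01 : 0 <= r <= 1.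

Let r_le1 : `|r| <= 1. Proof. by case/andP: r01 => r0 r1; rewrite ger0_norm. Qed.

Lemma error_summand_le1 s w : `|error_summand r s w| <= 1.
Proof.
rewrite /error_summand; case: (abundance w.1 s) => [|a].
  rewrite !expr0 mul1r expr0n; case: eqP => _; rewrite ?subrr ?subr0 ?normr0 ?normr1//.
by rewrite [0 ^+ _]expr0n/= mul0r subr0 normrX normrN exprn_ile1.
Qed.

Lemma variance_summand_le2 s w : `|variance_summand r s w| <= 2.
Proof.
rewrite /variance_summand (le_trans (ler_normB _ _))// !normrX normrN.
by rewrite -[leRHS]/(1 + 1) lerD// exprn_ile1.
Qed.

(** When [s] is seen [N > 0] times first, the left-hand side is at most
    [(2 * r ^+ N) ^+ 2]; when it is not, the left-hand side is [0]. This makes the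
    variance of the estimator at most four times its mean. *)
Lemma variance_summand_sqr_le s w :
  variance_summand r s w ^+ 2 <= 4 * error_summand r s w ^+ 2.
Proof.
rewrite error_summand_sqr /variance_summand mulnC exprM.
case: (abundance w.1 s) => [|a].
  rewrite !expr0 expr1n subrr mul1r (expr0n _ 2)/= expr0n.
  by case: (_ == _); rewrite /= ?subrr ?subr0 ?mulr0 ?mulr1.
rewrite expr0n/= mul0r subr0.
have : `|(- r) ^+ a.+1| <= 1 by rewrite normrX normrN exprn_ile1.
have -> : (r ^+ a.+1) ^+ 2 = ((- r) ^+ a.+1) ^+ 2 by rewrite -!exprM mulnC !exprM sqrrN.
move: (_ ^+ a.+1) => x /ler_normlP[x1 x2].
have : 0 <= x ^+ 2 * ((3 - x) * (1 + x)).
  by rewrite mulr_ge0 ?sqr_ge0// mulr_ge0//; lra.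
by lra.
Qed.

Definition at_most_singletons w := all (fun A : {fset S} => (#|` A| <= 1)%N) (w.1 ++ w.2).

(** A set with at most one element that contains [s'] does not contain [s]. *)
Lemma abundance_erase s s' xs : s' != s ->
  all (fun A : {fset S} => (#|` A| <= 1)%N) xs ->
  abundance (erase s xs) s' = abundance xs s'.
Proof.
move=> ss' /allP xs1; rewrite /abundance /erase count_filter.
apply: eq_in_count => A /xs1 A1 /=; case: (boolP (s' \in A)) => //= s'A.
apply/negP => sA.
have : ([fset s; s'] `<=` A)%fset by rewrite fsubUset !fsub1set sA s'A.
by move=> /fsubset_leq_card; rewrite cardfs2 eq_sym ss' leqNgt ltnS A1.
Qed.

Lemma error_summand_abundance s w w' : abundance w.1 s = abundance w'.1 s ->
  abundance w.2 s = abundance w'.2 s -> error_summand r s w = error_summand r s w'.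
Proof. by rewrite /error_summand => -> ->. Qed.

Lemma variance_summand_abundance s w w' : abundance w.1 s = abundance w'.1 s ->
  abundance w.2 s = abundance w'.2 s -> variance_summand r s w = variance_summand r s w'.
Proof. by rewrite /variance_summand => ->. Qed.

End species_statistics.

Section species_moments.
Context d (Omega : measurableType d) (R : realType) (P : probability Omega R).
Context (S : countType) (X : nat -> {RV P >-> {fset S}}) (n m : {RV P >-> nat}).
Context (mu : probability {fset S} R) (t r : R).
Hypotheses (t0 : 0 < t) (r0 : 0 < r) (r1 : r <= 1).
Hypothesis mu1 : forall A : {fset S}, (1 < #|` A|)%N -> mu [set A] = 0%E.
Hypothesis sampling : poissonized_sampling X n m mu t (r * t).
Let W := (seq {fset S} * seq {fset S})%type.
Let L := sample_mean X n m.
Let mL : mean_functional L := sample_mean_functional X n m.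
Let Y := error_summand r : S -> W -> R.
Let V := variance_summand r : S -> W -> R.
Let r01 : 0 <= r <= 1. Proof. by rewrite ltW. Qed.

(** The difference of the values of the generating function of the abundance of
    [s] in the first sample at [r ^+ 2] and [- r]. *)
Definition error_summand_variance s : R :=
  expR (- (t * species_prob mu s * (1 - r ^+ 2))) -
  expR (- (t * species_prob mu s * (1 + r))).
Let v := error_summand_variance.

Lemma error_summand_variance01 s : 0 <= v s <= 1.
Proof.
have p0 : 0 <= species_prob mu s by rewrite fine_ge0.
have tp0 : 0 <= t * species_prob mu s by rewrite mulr_ge0// ltW.
rewrite /v /error_summand_variance; apply/andP; split.
  rewrite subr_ge0 ler_expR lerN2 ler_wpM2l// lerD2l.
  by apply: (@le_trans _ _ 0); [rewrite oppr_le0 sqr_ge0|exact: ltW].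
rewrite lerBlDr (@le_trans _ _ 1)// ?lerDl ?expR_ge0//.
rewrite -[leRHS]expR0 ler_expR oppr_le0 mulr_ge0// subr_ge0 exprn_ile1//.
exact: ltW.
Qed.

Let sample_singletons :
  {ae P, forall w, at_most_singletons (first_sample X n w, second_sample X n m w)}.
Proof.
pose N : set {fset S} := [set A | (1 < #|` A|)%N].
have muN : mu N = 0%E.
  apply: measure_negligible => //.
  pose F j : set {fset S} := if @pickle_inv {fset S} j is Some A then N `&` [set A] else set0.
  have -> : N = \bigcup_j F j.
    apply/seteqP; split=> [A NA|A [j _]]; last by rewrite /F; case: pickle_inv => // B [].
    by exists (choice.pickle A) => //; rewrite /F pickleK_inv.
  apply: negligible_bigcup => j; rewrite /F; case: pickle_inv => [A|]; last exact: negligible_set0.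
  have [A1|A1] := boolP (1 < #|` A|)%N.
    by exists [set A]; split => //; exact: mu1.
  by exists set0; split => // B [NB BA]; move: A1; rewrite -BA NB.
have XN i : {ae P, forall w, (#|` X i w| <= 1)%N}.
  exists (X i @^-1` N); split.
  - by rewrite -[X in measurable X]setTI; exact: measurable_funPT.
  - by have /(congr1 (fun q => q N)) := law_sample sampling i; rewrite muN.
  - by move=> w /= /negP; rewrite -ltnNge.
apply: filterS (ae_foralln XN) => w Xw.
rewrite /at_most_singletons all_cat !all_map; apply/andP; split; apply/allP => i _ /=; exact: Xw.
Qed.

Let sample_mean_ae (f g : W -> R) : bounded_fct f -> bounded_fct g ->
  (forall w, at_most_singletons w -> f w = g w) -> L f = L g.
Proof.
move=> bf bg fg; congr fine; apply: ae_eq_integral => //.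
- by case/integrableP: (integrable_sample X n m bf).
- by case/integrableP: (integrable_sample X n m bg).
- by apply: filterS sample_singletons => w /fg /= -> _.
Qed.

Let bY s : bounded_fct (Y s).
Proof. by exists 1 => w; exact: error_summand_le1. Qed.

Let bV s : bounded_fct (V s).
Proof. by exists 2 => w; exact: variance_summand_le2. Qed.

(** [G] does not depend on [s]. The restriction to samples of sets with at most
    one element is needed because deleting the sets that contain [s] would
    otherwise change the abundances of other species. *)
Definition other_species s (G : W -> R) :=
  forall w, at_most_singletons w -> G (erase s w.1, erase s w.2) = G w.

(** The error is centred because the two terms of [error_summand] have the same
    mean: [exp (- t p (1 + r))] is both the generating function of a Poisson law of
    parameter [t p] at [- r] and the probability that both samples miss [s]. *)
Lemma mean_error_summand s G : bounded_fct G -> other_species s G ->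
  [/\ L (fun w => Y s w * G w) = 0,
      L (fun w => Y s w ^+ 2 * G w) = v s * L G &
      L (fun w => V s w * G w) = v s * L G].
Proof.
move=> bG oG.
have [C GC] := bG.
have gen z z' : `|z| <= 1 -> `|z'| <= 1 ->
    L (fun w => z ^+ abundance w.1 s * z' ^+ abundance w.2 s * G w) =
    expR (- (t * species_prob mu s * (1 - z)) - r * t * species_prob mu s * (1 - z')) * L G.
  move=> z1 z'1.
  have bz : bounded_fct (fun w : W => z ^+ abundance w.1 s * z' ^+ abundance w.2 s).
    by apply: boundedM; exists 1 => w; rewrite normrX exprn_ile1.
  have bGe : bounded_fct (fun w : W => G (erase s w.1, erase s w.2)) by exists C.
  rewrite -(sample_mean_ae bGe bG oG) -(sample_mean_generating _ _ sampling)// ?mulr_gt0//.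
  by apply: (sample_mean_ae (boundedM bz bG) (boundedM bz bGe)) => w /oG ->.
have bz2 (z z' : R) : `|z| <= 1 -> `|z'| <= 1 ->
  bounded_fct (fun w : W => z ^+ abundance w.1 s * z' ^+ abundance w.2 s * G w).
  move=> z1 z'1; apply: boundedM => //.
  by apply: boundedM; exists 1 => w; rewrite normrX exprn_ile1.
have n1 : `|1 : R| <= 1 by rewrite normr1.
have nz : `|0 : R| <= 1 by rewrite normr0.
have nr : `|- r| <= 1 by rewrite normrN ger0_norm// ltW.
have nr2 : `|r ^+ 2| <= 1 by rewrite normrX exprn_ile1// ger0_norm// ltW.
split.
- transitivity (L (fun w => (- r) ^+ abundance w.1 s * 1 ^+ abundance w.2 s * G w -
    0 ^+ abundance w.1 s * 0 ^+ abundance w.2 s * G w)).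
    by congr L; apply/funext => w; rewrite /Y /error_summand expr1n mulr1 mulrBl.
  rewrite (meanB mL); [|exact: bz2..].
  rewrite !gen// -mulrBl (_ : expR _ - expR _ = 0) ?mul0r//.
  by apply/eqP; rewrite subr_eq0; apply/eqP; congr expR; ring.
- transitivity (L (fun w => (r ^+ 2) ^+ abundance w.1 s * 1 ^+ abundance w.2 s * G w -
    0 ^+ abundance w.1 s * 0 ^+ abundance w.2 s * G w)).
    congr L; apply/funext => w.
    by rewrite /Y error_summand_sqr exprM expr1n mulr1 mulrBl.
  rewrite (meanB mL); [|exact: bz2..].
  by rewrite !gen// -mulrBl; congr ((expR _ - expR _) * _); ring.
- transitivity (L (fun w => (r ^+ 2) ^+ abundance w.1 s * 1 ^+ abundance w.2 s * G w -
    (- r) ^+ abundance w.1 s * 1 ^+ abundance w.2 s * G w)).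
    congr L; apply/funext => w.
    by rewrite /V /variance_summand exprM expr1n !mulr1 mulrBl.
  rewrite (meanB mL); [|exact: bz2..].
  by rewrite !gen// -mulrBl; congr ((expR _ - expR _) * _); ring.
Qed.

Lemma other_species_sum s (F : seq S) (f : S -> W -> R) (k : R -> R) :
  uniq (s :: F) -> (forall s' w w', abundance w.1 s' = abundance w'.1 s' ->
    abundance w.2 s' = abundance w'.2 s' -> f s' w = f s' w') ->
  other_species s (fun w => k (\sum_(s' <- F) f s' w)).
Proof.
move=> /andP[/= sF _] fE w; rewrite /at_most_singletons all_cat => /andP[w1 w2].
congr k; apply: eq_big_seq => s' s'F.
have ss' : s' != s by apply: contraNneq sF => <-.
by apply: fE; rewrite abundance_erase.
Qed.

(** Orthogonality: the cross terms vanish since each summand is centred given the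
    others. *)
Lemma mean_sum_error_sqr (F : seq S) : uniq F ->
  L (fun w => (\sum_(s <- F) Y s w) ^+ 2) = \sum_(s <- F) v s.
Proof.
elim: F => [_|s F IHF uF].
  under eq_fun do rewrite big_nil expr0n/=.
  by rewrite (mean_cst mL) big_nil.
have bS : bounded_fct (fun w => \sum_(s' <- F) Y s' w) by exact: bounded_sum.
have b1 : bounded_fct (fun _ : W => 1 : R) := bounded_cst 1.
have oS : other_species s (fun w => \sum_(s' <- F) Y s' w).
  exact: (other_species_sum id uF (@error_summand_abundance R S r)).
have [YS _ _] := mean_error_summand bS oS.
have [_ Y2 _] := mean_error_summand b1 (fun w _ => erefl) (s := s).
have bY2 : bounded_fct (fun w => Y s w ^+ 2) by exact: boundedX.
have bYS : bounded_fct (fun w => Y s w * (\sum_(s' <- F) Y s' w)) by exact: boundedM.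
have bS2 : bounded_fct (fun w => (\sum_(s' <- F) Y s' w) ^+ 2) by exact: boundedX.
transitivity (L (fun w => Y s w ^+ 2 + (2 * (Y s w * (\sum_(s' <- F) Y s' w)) +
    (\sum_(s' <- F) Y s' w) ^+ 2))).
  by congr L; apply/funext => w; rewrite big_cons; ring.
rewrite (meanD mL)//; last first.
  by apply: boundedD => //; apply: boundedM => //; exact: bounded_cst.
rewrite (meanD mL)//; last by apply: boundedM => //; exact: bounded_cst.
rewrite (meanZ mL)// YS mulr0 add0r IHF; last by case/andP: uF.
rewrite big_cons; congr (_ + _).
by move: Y2; rewrite (mean_cst mL) mulr1 => <-; congr L; apply/funext => w; rewrite mulr1.
Qed.

Lemma mean_sum_variance_dist (F : seq S) : uniq F ->
  L (fun w => (\sum_(s <- F) V s w - \sum_(s <- F) v s) ^+ 2) <= 4 * \sum_(s <- F) v s.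
Proof.
elim: F => [_|s F IHF uF].
  under eq_fun do rewrite !big_nil subrr expr0n/=.
  by rewrite (mean_cst mL) big_nil mulr0.
pose D w := \sum_(s' <- F) V s' w - \sum_(s' <- F) v s'.
have bD : bounded_fct D by apply: boundedB; [exact: bounded_sum|exact: bounded_cst].
have b1 : bounded_fct (fun _ : W => 1 : R) := bounded_cst 1.
have oD : other_species s D.
  exact: (other_species_sum (fun x => x - \sum_(s' <- F) v s') uF
    (@variance_summand_abundance R S r)).
have [_ _ VD] := mean_error_summand bD oD.
have [_ Y2 V1] := mean_error_summand b1 (fun w _ => erefl) (s := s).
have bV2 : bounded_fct (fun w => V s w ^+ 2) by exact: boundedX.
have bY2 : bounded_fct (fun w => Y s w ^+ 2) by exact: boundedX.
have bVD : bounded_fct (fun w => V s w * D w) by exact: boundedM.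
have bD2 : bounded_fct (fun w => D w ^+ 2) by exact: boundedX.
have bvV : bounded_fct (fun w => - (2 * v s) * V s w + v s ^+ 2).
  by apply: boundedD; [apply: boundedM|]; rewrite //; exact: bounded_cst.
have bvD : bounded_fct (fun w => 2 * (V s w * D w) + - (2 * v s) * D w).
  by apply: boundedD; apply: boundedM; rewrite //; exact: bounded_cst.
have -> : (fun w => (\sum_(s' <- s :: F) V s' w - \sum_(s' <- s :: F) v s') ^+ 2) =
    (fun w => V s w ^+ 2 + (- (2 * v s) * V s w + v s ^+ 2) +
      (2 * (V s w * D w) + - (2 * v s) * D w) + D w ^+ 2).
  by apply/funext => w; rewrite /D !big_cons; ring.
have LV : L (V s) = v s.
  move: V1; rewrite (mean_cst mL) mulr1 => <-.
  by congr L; apply/funext => w; rewrite mulr1.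
have LY2 : L (fun w => Y s w ^+ 2) = v s.
  move: Y2; rewrite (mean_cst mL) mulr1 => <-.
  by congr L; apply/funext => w; rewrite mulr1.
rewrite (meanD mL)//; last by apply: boundedD => //; exact: boundedD.
rewrite (meanD mL)//; last exact: boundedD.
rewrite (meanD mL)//.
rewrite (meanD mL); last 2 first.
- by apply: boundedM => //; exact: bounded_cst.
- exact: bounded_cst.
rewrite (meanZ mL)// LV (mean_cst mL).
rewrite (meanD mL); last 2 first.
- by apply: boundedM => //; exact: bounded_cst.
- by apply: boundedM => //; exact: bounded_cst.
rewrite !(meanZ mL)// VD [X in _ <= 4 * X]big_cons [leRHS]mulrDr.
apply: lerD; last by apply: IHF; case/andP: uF.
rewrite (_ : 2 * _ + _ = 0); last by ring.
have LV2 : L (fun w => V s w ^+ 2) <= 4 * v s.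
  rewrite -LY2 -(meanZ mL)//; apply: (mean_le mL) => //.
    by apply: boundedM => //; exact: bounded_cst.
  by move=> w; exact: variance_summand_sqr_le.
rewrite addr0; apply: le_trans LV2.
by rewrite gerDl (_ : _ + _ = - v s ^+ 2) ?oppr_le0 ?sqr_ge0//; ring.
Qed.

End species_moments.

(** * Reduction to finitely many species *)

Section decomposition.
Context {R : realType} {S : countType}.
Let W := (seq {fset S} * seq {fset S})%type.
Implicit Types (F : seq S) (w : W) (r : R).

Definition covers F w := forall s, (0 < abundance w.1 s + abundance w.2 s)%N -> s \in F.

Let card_fset_set F (A : set S) : uniq F -> A `<=` [set` F] ->
  #|` fset_set A|%:R = \sum_(s <- F) (s \in A)%:R :> R.
Proof.
move=> uF AF; have fA : finite_set A by exact: sub_finite_set AF (finite_seq F).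
have /perm_size -> : perm_eq (fset_set A) [seq s <- F | s \in A].
  apply: uniq_perm; rewrite ?fset_uniq ?filter_uniq// => s.
  rewrite mem_filter in_fset_set//; apply/idP/andP => [sA|[]//].
  by split=> //; exact: (AF s (set_mem sA)).
by rewrite size_filter -sum1_count natr_sum big_mkcond/=; apply: eq_bigr => s _; case: ifP.
Qed.

Let fsbig_cover F (f : S -> R) : uniq F -> (forall s, s \notin F -> f s = 0) ->
  \sum_(s \in [set: S]) f s = \sum_(s <- F) f s.
Proof.
move=> uF f0; rewrite (fsbigE F)//; last by move=> s _; exact: f0.
by apply: eq_bigl => s; rewrite in_setT.
Qed.

Lemma prediction_error_sum r F w : uniq F -> covers F w ->
  prediction_error r w.1 w.2 = \sum_(s <- F) error_summand r s w.
Proof.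
move=> uF cF; rewrite /prediction_error /num_new_species /num_species_both /num_species.
have ab0 s : s \notin F -> abundance w.1 s = 0%N /\ abundance w.2 s = 0%N.
  move=> sF; have : ~~ (0 < abundance w.1 s + abundance w.2 s)%N.
    by apply: contra sF; exact: cF.
  by rewrite lt0n negbK addn_eq0 => /andP[/eqP ? /eqP ?].
rewrite !(@card_fset_set F)//; last first.
  by move=> s /= s0; apply: cF; rewrite addn_gt0 s0.
rewrite /good_toulmin (@fsbig_cover F)//; last first.
  by move=> s /ab0[-> _]; rewrite mul0r.
rewrite opprK -sumrB -big_split/=; apply: eq_bigr => s _.
have mem_gt0 (f : S -> nat) : (s \in [set s | (0 < f s)%N]) = (0 < f s)%N.
  by apply/idP/idP => [/set_mem//|]; move=> ?; exact: mem_set.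
rewrite /error_summand !mem_gt0.
case: (abundance w.1 s) => [|a]; case: (abundance w.2 s) => [|b];
  by rewrite ?addn0 ?expr0 ?(exprS 0) ?mul0r ?mulr0 ?mul1r ?subrr ?subr0 ?add0r ?addr0.
Qed.

Lemma variance_estimator_sum r F w : uniq F -> covers F w ->
  variance_estimator r w.1 = \sum_(s <- F) variance_summand r s w.
Proof.
move=> uF cF; rewrite /variance_estimator /good_toulmin.
have ab0 s : s \notin F -> abundance w.1 s = 0%N.
  move=> sF; apply/eqP; rewrite -leqn0 leqNgt.
  by apply: contra sF => s0; apply: cF; rewrite addn_gt0 s0.
rewrite !(@fsbig_cover F)//; last 2 first.
- by move=> s /ab0 ->; rewrite mul0r.
- by move=> s /ab0 ->; rewrite mul0r.
rewrite -sumrB; apply: eq_bigr => s _; rewrite /variance_summand.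
by case: (abundance w.1 s) => [|a]; rewrite ?mul1r// !mul0r muln0 !expr0 !subrr.
Qed.

Definition first_species k : seq S := pmap pickle_inv (iota 0 k).

Lemma first_species_uniq k : uniq (first_species k).
Proof. by rewrite (pmap_uniq pickle_invK) ?iota_uniq. Qed.

Lemma mem_first_species k s : (s \in first_species k) = (choice.pickle s < k)%N.
Proof. by rewrite (can2_mem_pmap pickle_invK pickleK_inv) mem_iota. Qed.

Lemma first_species_cat k l : (k <= l)%N ->
  exists F, first_species l = first_species k ++ F.
Proof.
by move=> /subnKC <-; rewrite /first_species iotaD pmap_cat; eexists.
Qed.

Lemma covers_first_species w : \forall k \near \oo, covers (first_species k) w.
Proof.
pose seen := flatten [seq enum_fset A | A <- w.1 ++ w.2].
near=> k => s; rewrite mem_first_species => s0.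
suff sw : s \in seen.
  have : (\max_(s <- seen) (choice.pickle s).+1 < k.+1)%N.
    by near: k; exists (\max_(s <- seen) (choice.pickle s).+1) => //= k; rewrite ltnS.
  by rewrite ltnS; apply: leq_trans; exact: leq_bigmax_seq.
move: s0; rewrite /abundance -count_cat -has_count => /hasP[A Aw sA].
by apply/flattenP; exists (enum_fset A) => //; exact: map_f.
Unshelve. all: by end_near. Qed.

End decomposition.

Section truncation.
Context d (Omega : measurableType d) (R : realType) (P : probability Omega R).
Context (S : countType) (X : nat -> {RV P >-> {fset S}}) (n m : {RV P >-> nat}).
Context (mu : probability {fset S} R) (t r : R).
Hypotheses (t0 : 0 < t) (r0 : 0 < r) (r1 : r <= 1).
Hypothesis mu1 : forall A : {fset S}, (1 < #|` A|)%N -> mu [set A] = 0%E.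
Hypothesis sampling : poissonized_sampling X n m mu t (r * t).
Let W := (seq {fset S} * seq {fset S})%type.
Let L := sample_mean X n m.
Let mL : mean_functional L := sample_mean_functional X n m.
Let v := error_summand_variance mu t r.
Let Z := prediction_error_rv X n m r.

Let variance_le (M : R) : (\int[P]_w (Z w ^+ 2)%:E <= M%:E)%E -> ('V_P[Z] <= M%:E)%E.
Proof.
move=> ZM; have mZ : measurable_fun [set: Omega] Z.
  exact: (measurable_sample_statistic X n m (prediction_error r)).
have Z2 : Z \in Lfun P 2%:E.
  apply/andP; rewrite !inE/=; split => //.
  rewrite /finite_norm unlock; apply: poweR_lty.
  apply: le_lt_trans (ltry M); apply: le_trans ZM.
  rewrite le_eqVlt; apply/orP; left; apply/eqP; apply: eq_integral => w _.
  by rewrite /= powR_mulrn// real_normK ?num_real.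
have E1 := expectation_fin_num (Lfun_subset12 (fin_num_measure P _ measurableT) Z2).
rewrite varianceE// -(fineK E1) -EFin_expe leeBlDr//.
have -> : ('E_P[(Z ^+ 2)%R] = \int[P]_w (Z w ^+ 2)%:E)%E.
  by rewrite unlock; apply: eq_integral => w _; rewrite exprfctE.
apply: le_trans ZM _.
by rewrite leeDl// lee_fin sqr_ge0.
Qed.

(* Fatou: the error is the pointwise limit of its restrictions to the species of
   small code, whose second moments are the partial sums. *)
Let variance_bound (M : R) :
  (forall k, \sum_(s <- first_species k) v s <= M) -> ('V_P[Z] <= M%:E)%E.
Proof.
move=> vM; apply: variance_le.
pose F w : W := (first_sample X n w, second_sample X n m w).
pose f k (w : Omega) : \bar R := ((\sum_(s <- first_species k) error_summand r s (F w)) ^+ 2)%:E.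
have bf k : bounded_fct (fun w : W => (\sum_(s <- first_species k) error_summand r s w) ^+ 2).
  apply: boundedX; apply: bounded_sum => s; exists 1 => w.
  by apply: error_summand_le1; rewrite ltW.
have mf k : measurable_fun [set: Omega] (f k).
  by case/integrableP : (integrable_sample X n m (bf k)).
have f0 k w : (0 <= f k w)%E by rewrite lee_fin sqr_ge0.
have -> : (\int[P]_w (Z w ^+ 2)%:E = \int[P]_w limn_einf (f ^~ w))%E.
  apply: eq_integral => w _; apply/esym.
  apply: (fst (cvg_limn_einf_sup (l := (Z w ^+ 2)%:E) _)).
  apply: cvg_near_cst; near=> k; rewrite /f -prediction_error_sum ?first_species_uniq//.
  by near: k; exact: covers_first_species.
apply: le_trans (fatou P measurableT mf (fun k w _ => f0 k w)) _.
rewrite limn_einf_lim; apply: lime_le; first exact: is_cvg_einfs.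
apply: nearW => k; apply: (@le_trans _ _ (\int[P]_w f k w)%E).
  by apply: ereal_inf_lbound; exists k => //=.
have -> : (\int[P]_w f k w = (\sum_(s <- first_species k) v s)%:E)%E.
  rewrite -(mean_sum_error_sqr t0 r0 r1 mu1 sampling (first_species_uniq k)).
  by rewrite fineK//; exact: integrable_fin_num (integrable_sample X n m (bf k)).
by rewrite lee_fin.
Unshelve. all: by end_near. Qed.

(** Otherwise the partial sums of the variances, and hence the variance of the
    error, would be at most [M]. The probability of missing an observed species
    tends to 0 along the same enumeration. *)
Lemma finite_species (M e : R) : 0 < e -> (M%:E < 'V_P[Z])%E ->
  exists F : seq S, [/\ uniq F, M < \sum_(s <- F) v s &
    L (fun w => (`[< ~ covers F w >])%:R) < e].
Proof.
move=> e0 MV.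
have [k0 vk0] : exists k, M < \sum_(s <- first_species k) v s.
  apply: contrapT => nk; move: MV; rewrite ltNge => /negP; apply.
  apply: variance_bound => k; rewrite leNgt; apply/negP => vk; apply: nk; by exists k.
have uncovered : L (fun w => (`[< ~ covers (first_species k) w >])%:R) @[k --> \oo] --> (0 : R).
  rewrite -(mean_cst mL 0); apply: (@sample_mean_near _ _ _ _ _ _ _ _ _ _ 1).
    by move=> k w; case: asbool; rewrite ?normr1 ?normr0.
  move=> w; near=> k; have cF : covers (first_species k) w.
    by near: k; exact: covers_first_species.
  by case: asboolP => // /(_ cF).
near \oo => k; exists (first_species k); split.
- exact: first_species_uniq.
- have k0k : (k0 <= k)%N by near: k; exact: nbhs_infty_ge.
  have [F ->] := first_species_cat (S := S) k0k.
  rewrite big_cat/=; apply: (lt_le_trans vk0); rewrite lerDl.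
  by apply: sumr_ge0 => s _; case/andP: (error_summand_variance01 mu t0 r0 r1 s).
- near: k; have /cvgrPdist_lt/(_ e e0) := uncovered.
  by apply: filterS => k; rewrite sub0r normrN => /(le_lt_trans (ler_norm _)).
Unshelve. all: by end_near. Qed.

End truncation.

(** * Comparison of distribution functions *)

Section normal_step.
Context {R : realType}.
Implicit Types (a x y eta : R).

Definition normal_cdf a : R := fine (normal_prob 0 1 `]-oo, a]%classic).

Definition step_at eta a y : R := step (eta^-1 * y - a / eta).

Lemma step_at_bounds eta a y : 0 <= step_at eta a y <= 1.
Proof. by case: (step_bounds (eta^-1 * y - a / eta)). Qed.

Lemma step_at_eq1 eta a y : 0 < eta -> y <= a -> step_at eta a y = 1.
Proof.
move=> eta0 ya; apply: step_eq1.
by rewrite mulrC -mulrBl pmulr_lle0 ?invr_gt0// subr_le0.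
Qed.

Lemma step_at_eq0 eta a y : 0 < eta -> a + 3 * eta <= y -> step_at eta a y = 0.
Proof.
move=> eta0 ya; apply: step_eq0.
by rewrite mulrC -mulrBl ler_pdivlMr// lerBrDl.
Qed.

Lemma gauss_smooth_step_at eta a : 0 < eta ->
  normal_cdf a <= gauss_smooth (step_at eta a) 1 0 <= normal_cdf (a + 3 * eta).
Proof.
move=> eta0.
have mstep : measurable_fun [set: R] (step_at eta a).
  have [ms _ _] := @measurable_step R.
  by apply: measurableT_comp => //; apply: measurable_funB => //; exact: measurable_funM.
have iG : (@lebesgue_measure R).-integrable [set: R]
    (EFin \o (fun z => step_at eta a (0 + Num.sqrt 1 * z) * gauss_pdf z)).
  apply: (@integrable_poly_gauss_pdf _ _ 1) => [|z].
    by under eq_fun do rewrite add0r sqrtr1 mul1r.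
  have /andP[s0 s1] := step_at_bounds eta a (0 + Num.sqrt 1 * z).
  by rewrite mul1r ger0_norm// (le_trans s1)// lerDl exprn_ge0.
have GE : (gauss_smooth (step_at eta a) 1 0)%:E =
    (\int[lebesgue_measure]_z (step_at eta a z * gauss_pdf z)%:E)%E.
  rewrite /gauss_smooth /Rintegral fineK; last exact: integrable_fin_num iG.
  by apply: eq_integral => z _; rewrite add0r sqrtr1 mul1r.
have PE b : (normal_cdf b)%:E =
    (\int[lebesgue_measure]_z ((fun z => (gauss_pdf z)%:E) \_ `]-oo, b]) z)%E.
  rewrite -integral_mkcond /normal_cdf fineK//.
  exact: (fin_num_measure (normal_prob 0 1)).
have mP b : measurable_fun [set: R] ((fun z : R => (gauss_pdf z)%:E) \_ `]-oo, b]).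
  apply/(measurable_restrictT _ _).1 => //.
  by apply: measurable_funTS; apply/measurable_EFinP; exact: measurable_gauss_pdf.
have mG : measurable_fun [set: R] (fun z : R => (step_at eta a z * gauss_pdf z)%:E).
  by apply/measurable_EFinP; apply: measurable_funM => //; exact: measurable_gauss_pdf.
have P0 b z : (0 <= ((fun z : R => (gauss_pdf z)%:E) \_ `]-oo, b]) z)%E.
  by rewrite patchE; case: ifP => // _; rewrite lee_fin gauss_pdf_ge0.
have G0 z : (0 <= (step_at eta a z * gauss_pdf z)%:E)%E.
  by have /andP[s0 _] := step_at_bounds eta a z; rewrite lee_fin mulr_ge0 ?gauss_pdf_ge0.
apply/andP; split; rewrite -lee_fin GE PE; (apply: ge0_le_integral;
  [exact: measurableT|by move=> z _; first [exact: P0|exact: G0]|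
   first [exact: mP|exact: mG]|first [exact: mP|exact: mG]|move=> z _]).
- rewrite patchE; case: ifPn => [|_]; last exact: G0.
  rewrite inE/= in_itv/= => za.
  by rewrite lee_fin step_at_eq1// mul1r.
- rewrite patchE; case: ifPn => [_|].
    have /andP[s0 s1] := step_at_bounds eta a z.
    by rewrite lee_fin ler_piMl// gauss_pdf_ge0.
  rewrite notin_setE/= in_itv/= => /negP za.
  by rewrite step_at_eq0 ?mul0r// ltW// ltNge.
Qed.

End normal_step.

Section studentized.
Context d (Omega : measurableType d) (R : realType) (P : probability Omega R).
Context (S : countType) (X : nat -> {RV P >-> {fset S}}) (n m : {RV P >-> nat}).
Context (mu : probability {fset S} R) (t r c : R).
Hypotheses (t0 : 0 < t) (r0 : 0 < r) (r1 : r <= 1).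
Hypothesis mu1 : forall A : {fset S}, (1 < #|` A|)%N -> mu [set A] = 0%E.
Hypothesis sampling : poissonized_sampling X n m mu t (r * t).
Let W := (seq {fset S} * seq {fset S})%type.
Let L := sample_mean X n m.
Let mL : mean_functional L := sample_mean_functional X n m.
Let v := error_summand_variance mu t r.
Let r01 : 0 <= r <= 1. Proof. by rewrite ltW. Qed.

Variable F : seq S.
Hypothesis uF : uniq F.
Let s2 := \sum_(s <- F) v s.
Hypothesis s2_gt0 : 0 < s2.
Let sigma := Num.sqrt s2.
Let U (w : W) := \sum_(s <- F) error_summand r s w.
Let V (w : W) := \sum_(s <- F) variance_summand r s w.

Let sigma_gt0 : 0 < sigma. Proof. by rewrite sqrtr_gt0. Qed.

Let bounded_step_at eta a (f : W -> R) : bounded_fct (fun w => step_at eta a (f w)).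
Proof.
by exists 1 => w; have /andP[? ?] := step_at_bounds eta a (f w); rewrite ger0_norm.
Qed.

(* In the replacement bound the third derivative contributes [s2 ^ (-3/2)] and the
   sum of the variances contributes [s2]. *)
Let clt_step_at eta a : 0 < eta ->
  `|L (fun w => step_at eta a (U w / sigma)) - gauss_smooth (step_at eta a) 1 0|
    <= 3 * (1 + gauss_abs3) / eta ^+ 3 / sigma.
Proof.
move=> eta0; pose k := eta^-1 / sigma; pose b := - (a / eta).
have k0 : 0 <= k by rewrite divr_ge0 ?invr_ge0// ltW.
have maff : measurable_fun [set: R] (fun x => k * x + b).
  by apply: measurable_funD => //; exact: measurable_funM.
have [ms ms1 ms2] := @measurable_step R.
have : `|L (fun w => step (k * U w + b)) -
    gauss_smooth (fun x => step (k * x + b)) s2 0| <= 3 * k ^+ 3 * (1 + gauss_abs3) * s2.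
  apply: (lindeberg mL _ _ _ (cubic_taylor_affine b k0 (@cubic_taylor_step R))
    (B := k + k ^+ 2)) => //.
  - by move=> s w; exact: error_summand_le1.
  - exact: error_summand_variance01.
  - move=> s F' uF' h bh.
    have oh := other_species_sum h uF' (@error_summand_abundance R S r).
    have bhU : bounded_fct (fun w : W => h (\sum_(j <- F') error_summand r j w)).
      by case: bh => C hC; exists C.
    by have [? ? _] := mean_error_summand t0 r0 r1 mu1 sampling bhU oh.
  - by move=> x; case: (step_bounds (k * x + b)).
  - exact: measurableT_comp.
  - by apply: measurable_funM => //; exact: measurableT_comp.
  - by apply: measurable_funM => //; exact: measurableT_comp.
  - move=> x; have [_ s1 _] := step_bounds (k * x + b).
    by rewrite normrM (ger0_norm k0) ler_wpDr ?sqr_ge0// ler_piMr.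
  - move=> x; have [_ _ s1] := step_bounds (k * x + b).
    by rewrite normrM normrX (ger0_norm k0) ler_wpDl// ler_piMr// sqr_ge0.
have -> : (fun w => step (k * U w + b)) = (fun w => step_at eta a (U w / sigma)).
  by apply/funext => w; rewrite /step_at /k /b mulrAC mulrA.
have -> : gauss_smooth (fun x => step (k * x + b)) s2 0 = gauss_smooth (step_at eta a) 1 0.
  apply: eq_Rintegral => z _; rewrite /step_at /k /b !add0r -/sigma sqrtr1 mul1r.
  by rewrite mulrA divfK// gt_eqF.
rewrite [X in _ <= X](_ : _ = 3 * (1 + gauss_abs3) / eta ^+ 3 / sigma)//.
rewrite /k -[s2 in LHS]sqr_sqrtr ?(ltW s2_gt0)// -/sigma.
by field; rewrite !gt_eqF.
Qed.

(* The second half of Slutsky's argument: the variance estimator is concentrated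
   around the variance. *)
Let mean_variance_ratio : L (fun w => (V w / s2 - 1) ^+ 2) <= 4 / s2.
Proof.
have bV : bounded_fct V.
  by apply: bounded_sum => s; exists 2 => w; exact: variance_summand_le2.
have -> : (fun w => (V w / s2 - 1) ^+ 2) = (fun w => s2 ^- 2 * (V w - s2) ^+ 2).
  by apply/funext => w; field; rewrite gt_eqF.
rewrite (meanZ mL); last by apply: boundedX; apply: boundedB => //; exact: bounded_cst.
have := mean_sum_variance_dist t0 r0 r1 mu1 sampling uF; rewrite -/v -/s2 => VM.
apply: le_trans (ler_wpM2l _ VM) _; first by rewrite invr_ge0 exprn_ge0// ltW.
by rewrite le_eqVlt; apply/orP; left; apply/eqP; field; rewrite gt_eqF.
Qed.

Let uncovered w : R := (`[< ~ covers F w >])%:R.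
Let studentized_le (x : R) (w : W) : R := (studentized_error r c w.1 w.2 <= x)%R%:R.

Let bounded_bool (B : W -> bool) : bounded_fct (fun w => (B w)%:R : R).
Proof. by exists 1 => w; case: (B w); rewrite ?normr1 ?normr0. Qed.

(* Where the variance estimator is within a relative error [kappa] of the
   variance, replacing one by the other moves the threshold [x] by at most
   [`|x| * kappa], because [|q - 1| <= |q ^ 2 - 1|] for [q >= 0]. *)
Let studentized_threshold x kappa w : 0 < kappa <= 2^-1 -> covers F w ->
  `|V w / s2 - 1| <= kappa ->
  (U w / sigma <= x - `|x| * kappa -> studentized_error r c w.1 w.2 <= x) /\
  (studentized_error r c w.1 w.2 <= x -> U w / sigma <= x + `|x| * kappa).
Proof.
move=> /andP[kappa0 kappa1] cF VB.
rewrite /studentized_error (variance_estimator_sum r uF cF) (prediction_error_sum r uF cF).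
rewrite -/(V w) -/(U w).
have B0 : 0 < V w / s2 by move: VB => /ler_normlP[]; lra.
have V0 : 0 < V w by move: B0; rewrite pmulr_lgt0 ?invr_gt0.
pose q := Num.sqrt (V w / s2).
have q0 : 0 < q by rewrite sqrtr_gt0.
have qE : Num.sqrt (V w) = q * sigma.
  by rewrite -sqrtrM ?(ltW B0)// divfK// gt_eqF.
have q1 : `|q - 1| <= kappa.
  apply: le_trans VB; have -> : V w / s2 = q ^+ 2 by rewrite sqr_sqrtr// ltW.
  rewrite (_ : q ^+ 2 - 1 = (q - 1) * (q + 1)); last by ring.
  by rewrite normrM ler_peMr// ger0_norm; lra.
rewrite V0 qE.
have -> : (U w / (q * sigma) <= x) = (U w / sigma <= x * q).
  by rewrite !ler_pdivrMr ?mulr_gt0// mulrA.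
have /ler_normlP[xq1 xq2] : `|x * q - x| <= `|x| * kappa.
  by rewrite -[X in _ - X]mulr1 -mulrBr normrM ler_wpM2l.
by split => /le_trans; apply; lra.
Qed.

(** The indicator of the event lies between two smooth steps of the normalized
    error, up to the indicator of an uncovered sample and up to
    [kappa ^- 2 * (V / s2 - 1) ^+ 2], which is at least 1 where the relative
    error of the variance estimator exceeds [kappa]. *)
Lemma studentized_cdf_bound x kappa eta : 0 < kappa <= 2^-1 -> 0 < eta ->
  let err := 3 * (1 + gauss_abs3) / eta ^+ 3 / sigma + L uncovered +
             4 / kappa ^+ 2 / s2 in
  normal_cdf (x - `|x| * kappa - 3 * eta) - err <= L (studentized_le x) /\
  L (studentized_le x) <= normal_cdf (x + `|x| * kappa + 3 * eta) + err.
Proof.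
move=> kappa01 eta0 err; have /andP[kappa0 _] := kappa01.
pose dev w := kappa ^- 2 * (V w / s2 - 1) ^+ 2.
have bV : bounded_fct (fun w => (V w / s2 - 1) ^+ 2).
  apply: boundedX; apply: boundedB; last exact: bounded_cst.
  apply: boundedM; last exact: bounded_cst.
  by apply: bounded_sum => s; exists 2 => w; exact: variance_summand_le2.
have bdev : bounded_fct dev by apply: boundedM => //; exact: bounded_cst.
have Ldev : L dev <= 4 / kappa ^+ 2 / s2.
  rewrite (meanZ mL)// (mulrC 4) -mulrA.
  by apply: ler_wpM2l => //; rewrite invr_ge0 exprn_ge0// ltW.
have dev0 w : 0 <= dev w by rewrite mulr_ge0 ?sqr_ge0// invr_ge0 exprn_ge0// ltW.
have unc0 w : 0 <= uncovered w by rewrite ler0n.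
have bu : bounded_fct uncovered := bounded_bool _.
have bs : bounded_fct (studentized_le x) := bounded_bool _.
have good w : uncovered w + dev w < 1 -> covers F w /\ `|V w / s2 - 1| <= kappa.
  move=> ud; split.
    apply: contrapT => nF; move: ud; rewrite /uncovered asboolT//.
    by rewrite ltNge lerDl dev0.
  rewrite leNgt; apply/negP => kV; move: ud; rewrite ltNge => /negP; apply.
  apply: (@le_trans _ _ (dev w)); last by rewrite lerDr.
  rewrite /dev mulrC ler_pdivlMr ?exprn_gt0// mul1r -(real_normK (num_real (_ - 1))).
  by rewrite lerXn2r ?nnegrE ?(ltW kappa0)// ltW.
have std0 w : 0 <= studentized_le x w <= 1 by rewrite ler0n lern1; case: (_ <= x).
split.
- pose a := x - `|x| * kappa - 3 * eta.
  pose f w := step_at eta a (U w / sigma).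
  have bf : bounded_fct f := bounded_step_at _ _ _.
  have /andP[Ga _] := gauss_smooth_step_at a eta0.
  have /ler_normlP[Gf _] := clt_step_at a eta0.
  suff : L f <= L (fun w => studentized_le x w + (uncovered w + dev w)).
    rewrite (meanD mL)//; last exact: boundedD.
    rewrite (meanD mL)// => Lf; move: Ga Gf Lf Ldev; rewrite -/f /err /a.
    lra.
  apply: (mean_le mL) => //; first by apply: boundedD => //; exact: boundedD.
  move=> w; have /andP[f0 f1] := step_at_bounds eta a (U w / sigma).
  have /andP[st0 st1] := std0 w; have ud0 : 0 <= uncovered w + dev w by exact: addr_ge0.
  have [/good[cF VB]|ud1] := ltP (uncovered w + dev w) 1; last first.
    by rewrite /f; lra.
  have [Ux _] := studentized_threshold x kappa01 cF VB.
  have [xU|Ux'] := leP (x - `|x| * kappa) (U w / sigma).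
    by rewrite /f step_at_eq0// ?addr_ge0// /a subrK.
  rewrite /studentized_le Ux ?(ltW Ux')//.
  by apply: le_trans f1 _; rewrite lerDl.
- pose a := x + `|x| * kappa.
  pose f w := step_at eta a (U w / sigma).
  have bf : bounded_fct f := bounded_step_at _ _ _.
  have /andP[_ Ga] := gauss_smooth_step_at a eta0.
  have /ler_normlP[_ Gf] := clt_step_at a eta0.
  suff : L (studentized_le x) <= L (fun w => f w + (uncovered w + dev w)).
    rewrite (meanD mL)//; last exact: boundedD.
    rewrite (meanD mL)// => Lf; move: Ga Gf Lf Ldev; rewrite -/f /err /a.
    lra.
  apply: (mean_le mL) => //; first by apply: boundedD => //; exact: boundedD.
  move=> w; have /andP[f0 f1] := step_at_bounds eta a (U w / sigma).
  have /andP[st0 st1] := std0 w; have ud0 : 0 <= uncovered w + dev w by exact: addr_ge0.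
  have [/good[cF VB]|ud1] := ltP (uncovered w + dev w) 1; last first.
    by rewrite /f; lra.
  have [_ Ux] := studentized_threshold x kappa01 cF VB.
  rewrite /studentized_le; case: (boolP (_ <= x)) => [/Ux Ua|_]; last exact: addr_ge0.
  by rewrite /f step_at_eq1// lerDl.
Qed.

End studentized.

(** * The central limit theorem *)

Section cdf_of_studentized_error.
Context d (Omega : measurableType d) (R : realType) (P : probability Omega R).
Context (S : countType) (X : nat -> {RV P >-> {fset S}}) (n m : {RV P >-> nat}).

Lemma cdf_studentized_error (r c x : R) :
  cdf (studentized_error_rv X n m r c : {RV P >-> R}) x =
  (sample_mean X n m (fun w => (studentized_error r c w.1 w.2 <= x)%R%:R))%:E.
Proof.
transitivity (P [set w | [set w | studentized_error r c w.1 w.2 <= x]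
    (first_sample X n w, second_sample X n m w)]).
  congr (P _); apply/seteqP; split=> w; rewrite /preimage/= in_itv/=; exact.
rewrite sample_mean_indic; congr (sample_mean _ _ _ _)%:E; apply/funext => w.
rewrite indicE (_ : (w \in _) = (studentized_error r c w.1 w.2 <= x))//.
by apply/idP/idP => [/set_mem//|]; exact: mem_set.
Qed.

End cdf_of_studentized_error.

Theorem corollary15 (R : realType) (S : countType)
    (mu : probability {fset S} R) (r c : R)
    (d : R -> measure_display) (Omega : forall t : R, measurableType (d t))
    (P : forall t : R, probability (Omega t) R)
    (X : forall t : R, nat -> {RV (P t) >-> {fset S}})
    (n m : forall t : R, {RV (P t) >-> nat}) :
  0 < r -> r <= 1 ->
  (forall A : {fset S}, (1 < #|` A|)%N -> mu [set A] = 0%E) ->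
  (forall t : R, 0 < t ->
     poissonized_sampling (X t) (n t) (m t) mu t (r * t)) ->
  'V_(P t)[prediction_error_rv (X t) (n t) (m t) r]%E @[t --> +oo%R] --> +oo%E ->
  cvg_in_distribution
    (fun t : R => studentized_error_rv (X t) (n t) (m t) r c : {RV (P t) >-> R})
    (normal_prob 0 1).
Proof.
move=> r0 r1 mu1 sampling VZ x cx.
have fin_normal (y : R) : normal_prob 0 1 `]-oo, y]%classic \is a fin_num.
  exact: (fin_num_measure (normal_prob 0 1)).
have cPhi : {for x, continuous (@normal_cdf R)}.
  by apply: fine_cvg; rewrite fineK.
rewrite -[X in _ --> X]fineK ?fin_normal//; apply/fine_cvgP; split.
  by apply: nearW => t; rewrite cdf_studentized_error.
apply/cvgrPdist_lt => e e0.
have e4 : 0 < e / 4 by rewrite divr_gt0.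
have [delta /= delta0 Phi_delta] : exists2 delta : R, 0 < delta & forall y,
    `|y - x| < delta -> `|normal_cdf y - normal_cdf x| < e / 4.
  have /cvgrPdist_lt/(_ _ e4) := cPhi.
  move=> [delta /= delta0 H]; exists delta => // y yx.
  by rewrite distrC; apply: H; rewrite /= distrC.
(* The thresholds of the sandwich are moved by [`|x| * kappa + 3 * eta], which is at
   most [delta / 2]. *)
pose kappa := Num.min 2^-1 (delta / 4 / (`|x| + 1)); pose eta := delta / 12.
have x1 : 0 < `|x| + 1 by rewrite ltr_wpDl.
have eta0 : 0 < eta by rewrite divr_gt0.
have kappa0 : 0 < kappa by rewrite lt_min invr_gt0 ltr0n !divr_gt0.
have kappa01 : 0 < kappa <= 2^-1 by rewrite kappa0 ge_min lexx.
have xkappa : `|x| * kappa <= delta / 4.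
  apply: (@le_trans _ _ ((`|x| + 1) * (delta / 4 / (`|x| + 1)))).
    by apply: ler_pM => //; [exact: ltW|rewrite lerDl|rewrite ge_min lexx orbT].
  by rewrite mulrC divfK// gt_eqF.
pose C1 := 3 * (1 + gauss_abs3) / eta ^+ 3 : R; pose C2 := 4 / kappa ^+ 2.
have C10 : 0 <= C1.
  by rewrite divr_ge0 ?exprn_ge0 ?(ltW eta0)// mulr_ge0// addr_ge0// gauss_abs3_ge0.
have C20 : 0 <= C2 by rewrite divr_ge0// exprn_ge0// ltW.
(* If [s2 > M], then [Num.sqrt s2] exceeds both 1 and [4 * (C1 + C2) / e]. *)
pose M := 1 + (4 * (C1 + C2) / e) ^+ 2.
near=> t.
have t0 : 0 < t by near: t; exact: nbhs_pinfty_gt.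
have MV : (M%:E < 'V_(P t)[prediction_error_rv (X t) (n t) (m t) r])%E.
  by near: t; move/cvgeyPgt : VZ; exact.
have [F [uF MF unc]] := finite_species t0 r0 r1 mu1 (sampling t t0) e4 MV.
have s20 : 0 < \sum_(s <- F) error_summand_variance mu t r s.
  by apply: lt_trans MF; rewrite ltr_pwDl// sqr_ge0.
have [lo hi] := studentized_cdf_bound c t0 r0 r1 mu1 (sampling t t0) uF s20 x kappa01 eta0.
rewrite /= cdf_studentized_error/= -/(normal_cdf x).
move: MF lo hi unc; rewrite -/C1 -/C2.
set s2 := \sum_(s <- F) _ => MF.
set L1 := sample_mean _ _ _ (fun w => (_ <= _)%R%:R).
set L2 := sample_mean _ _ _ _ => lo hi unc.
have small : C1 / Num.sqrt s2 + C2 / s2 < e / 4.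
  have C0 : 0 <= 4 * (C1 + C2) / e by rewrite divr_ge0 ?(ltW e0)// mulr_ge0// addr_ge0.
  have sg : 1 <= Num.sqrt s2.
    by rewrite -sqrtr1 ler_wsqrtr// (le_trans _ (ltW MF))// lerDl sqr_ge0.
  have sC : 4 * (C1 + C2) / e < Num.sqrt s2.
    rewrite -[ltLHS]ger0_norm// -sqrtr_sqr ltr_sqrt//.
    by apply: lt_trans MF; rewrite ltrDr.
  have s0 : 0 < Num.sqrt s2 by rewrite sqrtr_gt0.
  have CC : (C1 + C2) / Num.sqrt s2 < e / 4.
    rewrite ltr_pdivrMr//; move: sC; rewrite ltr_pdivrMr//.
    by move: (C1 + C2) (Num.sqrt s2) => C s; lra.
  apply: le_lt_trans CC; rewrite mulrDl lerD2l ler_wpM2l// lef_pV2 ?posrE//.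
  by rewrite -[leRHS](sqr_sqrtr (ltW s20)) expr2 ler_peMl// ltW.
have xlo := Phi_delta (x - `|x| * kappa - 3 * eta).
have xhi := Phi_delta (x + `|x| * kappa + 3 * eta).
have xk0 : 0 <= `|x| * kappa by rewrite mulr_ge0// ltW.
have /ler_normlP[? ?] : `|normal_cdf (x - `|x| * kappa - 3 * eta) - normal_cdf x| <= e / 4.
  by apply/ltW/xlo/ltr_normlP; rewrite /eta; split; lra.
have /ler_normlP[? ?] : `|normal_cdf (x + `|x| * kappa + 3 * eta) - normal_cdf x| <= e / 4.
  by apply/ltW/xhi/ltr_normlP; rewrite /eta; split; lra.
by apply/ltr_normlP; split; lra.
Unshelve. all: by end_near. Qed.
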